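(* Let $\gamma$ be a smooth strictly convex closed plane curve with curvature function $k>0$ with minimal value $k_{\min}$, and let $R>0$ satisfy $1/R<k_{\min}$. For integers $1\le p<q$ let $M_{p,q}$ be the greatest value of $$P-\frac1R A$$ over the curvilinear $q$-gons with rotation number $p$ inscribed in $\gamma$ whose oriented sides are counterclockwise circular arcs of radius $R$, where $P$ is the perimeter of the curvilinear $q$-gon and $A$ is the area enclosed by it. Then for all relatively prime positive integers $p,q$ with $p<q-1$, $$M_{p,q-1}+M_{p,q+1}<2M_{p,q}.$$
   Context: Parameterize $\gamma$ counterclockwise by a regular $1$-periodic map $\gamma:\mathbb{R}\to\mathbb{R}^2$, injective on $[0,1)$. For two distinct points $\gamma(x),\gamma(x')$ let $a(x,x')$ denote the arc of a circle of radius $R$ going counterclockwise (with respect to the center of that circle) from $\gamma(x)$ to $\gamma(x')$ and shorter than a half-circle, so that the angle between the arc and the chord is less than $\pi/2$ (under the assumption $1/R<k_{\min}$ such an arc exists and is unique; it lies inside $\gamma$). If $\gamma(x)=\gamma(x')$ the arc is degenerate (a point). An inscribed curvilinear $q$-gon with rotation number $p$ is given by real numbers $x_0\le x_1\le\dots\le x_q=x_0+p$ with $0\le x_{i+1}-x_i\le1$; its sides are the arcs $a(x_i,x_{i+1})$, $i=0,\dots,q-1$. Its perimeter $P$ is the sum of the lengths of these arcs, and its enclosed area $A$ is the algebraic area $\frac12\oint(u\,dv-v\,du)$ of the resulting closed oriented curve in Cartesian coordinates $(u,v)$ (area counted with winding numbers). The integers $p,q$ in the definition of $M_{p,q}$ need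 not be relatively prime. *)

(* Defs.v *)
From Stdlib Require Import Reals.
From Coquelicot Require Import Coquelicot.

Open Scope R_scope.

Definition is_least (E : R -> Prop) (m : R) : Prop :=
  E m /\ forall y, E y -> m <= y.

Definition is_greatest (E : R -> Prop) (m : R) : Prop :=
  E m /\ forall y, E y -> y <= m.

(** ** Parametrized plane curves, in Cartesian coordinates [(u, v)] *)

Definition ucoord (g : R -> R * R) (t : R) : R := fst (g t).
Definition vcoord (g : R -> R * R) (t : R) : R := snd (g t).

Definition smooth (g : R -> R * R) : Prop :=
  forall (n : nat) (t : R), ex_derive_n (ucoord g) n t /\ ex_derive_n (vcoord g) n t.

Definition regular (g : R -> R * R) : Prop :=
  forall t, (Derive (ucoord g) t, Derive (vcoord g) t) <> (0, 0).

Definition curve_length (g : R -> R * R) (a b : R) : R :=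
  RInt (fun t => sqrt (Derive (ucoord g) t ^ 2 + Derive (vcoord g) t ^ 2)) a b.

(** The integral of [(u dv - v du) / 2] along [g] restricted to [[a, b]]. *)
Definition area_integral (g : R -> R * R) (a b : R) : R :=
  / 2 * RInt (fun t => ucoord g t * Derive (vcoord g) t
                       - vcoord g t * Derive (ucoord g) t) a b.

(** Signed with respect to the direction of travel. *)
Definition curvature (g : R -> R * R) (t : R) : R :=
  (Derive (ucoord g) t * Derive_n (vcoord g) 2 t
   - Derive (vcoord g) t * Derive_n (ucoord g) 2 t)
  / sqrt (Derive (ucoord g) t ^ 2 + Derive (vcoord g) t ^ 2) ^ 3.

(** Positive, zero or negative according to whether [g t] is to the left of,
    on, or to the right of the tangent line directed by the velocity at [g s]. *)
Definition tangent_side (g : R -> R * R) (s t : R) : R :=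
  Derive (ucoord g) s * (vcoord g t - vcoord g s)
  - Derive (vcoord g) s * (ucoord g t - ucoord g s).

(** Each tangent line meets the curve only at the point of tangency and leaves
    the rest of the curve on one side. *)
Definition strictly_convex (g : R -> R * R) : Prop :=
  forall s,
    (forall t, g t <> g s -> 0 < tangent_side g s t) \/
    (forall t, g t <> g s -> tangent_side g s t < 0).

(** A regular 1-periodic counterclockwise parametrization of a smooth strictly
    convex simple closed curve; the orientation is expressed by the sign of the
    enclosed area. *)
Record convex_curve (g : R -> R * R) : Prop := {
  cc_smooth : smooth g;
  cc_regular : regular g;
  cc_periodic : forall t, g (t + 1) = g t;
  cc_injective : forall s t, 0 <= s < 1 -> 0 <= t < 1 -> g s = g t -> s = t;
  cc_counterclockwise : 0 < area_integral g 0 1;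
  cc_strictly_convex : strictly_convex g
}.

(** ** Arcs of circles of radius [r] *)

Record arc := Arc { center : R * R; angle_from : R; angle_to : R }.

Definition arc_point (r : R) (a : arc) (theta : R) : R * R :=
  (fst (center a) + r * cos theta, snd (center a) + r * sin theta).

(** The arc is travelled in the direction of increasing angle, and is shorter
    than a half-circle.  When [A = B] this forces the two angles to coincide, so
    that the arc is reduced to a point (its center is then irrelevant). *)
Definition arc_joins (r : R) (a : arc) (A B : R * R) : Prop :=
  angle_from a <= angle_to a < angle_from a + PI /\
  arc_point r a (angle_from a) = A /\
  arc_point r a (angle_to a) = B.

(** ** Inscribed curvilinear polygons

    A [q]-gon consists of the parameters [x 0, ..., x q] of its vertices and of
    its sides [a 0, ..., a (q - 1)]; other values of [x] and [a] are ignored. *)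

Definition inscribed_polygon (g : R -> R * R) (r : R) (p q : nat)
    (x : nat -> R) (a : nat -> arc) : Prop :=
  (forall i, (i < q)%nat -> 0 <= x (S i) - x i <= 1) /\
  x q = x O + INR p /\
  (forall i, (i < q)%nat -> arc_joins r (a i) (g (x i)) (g (x (S i)))).

(** For [q >= 1], [sum_f_R0 f (q - 1)] is the sum of the [q] terms
    [f 0, ..., f (q - 1)]. *)

Definition perimeter (r : R) (q : nat) (a : nat -> arc) : R :=
  sum_f_R0 (fun i =>
    curve_length (arc_point r (a i)) (angle_from (a i)) (angle_to (a i))) (q - 1).

Definition enclosed_area (r : R) (q : nat) (a : nat -> arc) : R :=
  sum_f_R0 (fun i =>
    area_integral (arc_point r (a i)) (angle_from (a i)) (angle_to (a i))) (q - 1).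

(** The values of [P - A / r] over the inscribed curvilinear [q]-gons with
    rotation number [p]. *)
Definition polygon_value (g : R -> R * R) (r : R) (p q : nat) (y : R) : Prop :=
  exists (x : nat -> R) (a : nat -> arc),
    inscribed_polygon g r p q x a /\
    y = perimeter r q a - / r * enclosed_area r q a.

(* Main.v *)
Require Import Defs.
From Stdlib Require Import Reals ZArith Lra Lia Arith Classical IndefiniteDescription.
From Coquelicot Require Import Coquelicot.

Open Scope R_scope.

(** The value of a polygon is the sum of the values [L x x'] of its sides, where
    [L] is a continuous function that depends only on the end points of a side.

    Since [1 / r < kmin], the whole curve lies strictly inside the circle of
    radius [r] tangent to it at any of its points (Blaschke).  Hence all arcs
    exist and meet the curve transversally from inside, which gives the twist
    condition: the mixed second derivative of [L] is positive.  In other words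
    [L x x' + L y y' < L x y' + L y x'] for [x < y <= y' < x' <= x + 1].

    Now let [x] and [y] be maximal polygons with [q - 1] and [q + 1] sides.  As
    sequences, [x] advances faster than [y], so an edge of [x] covers an edge of
    [y]; swapping tails there, and again where [x] overtakes the shift of [y] by
    one index, turns them into two [q]-gons without decreasing the total value.
    If the value did not increase, then [x] and [y] would share a vertex at the
    first swap and one of the new [q]-gons would be maximal; it would have two
    consecutive vertices in common with [y], but not the next one, contrary to
    the Euler-Lagrange equation. *)

(** * Maximal orbits of twist functions *)

Lemma periodic_Z {A : Type} (f : R -> A) : (forall t, f (t + 1) = f t) ->
  forall (z : Z) t, f (t + IZR z) = f t.
Proof.
  intros H.
  assert (P : forall (n : nat) t, f (t + INR n) = f t).
  { induction n as [|n IH]; intros t; [simpl; f_equal; lra|].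
    now rewrite S_INR, <- Rplus_assoc, H. }
  intros z t. destruct (Z_lt_le_dec z 0) as [h|h].
  - rewrite <- (P (Z.to_nat (- z))).
    rewrite INR_IZR_INZ, Z2Nat.id, opp_IZR by lia. f_equal; ring.
  - replace z with (Z.of_nat (Z.to_nat z)) by lia.
    rewrite <- INR_IZR_INZ. apply P.
Qed.

Lemma translate_into_period x w : exists z : Z, x <= w + IZR z < x + 1.
Proof.
  exists (- (up (w - x) - 1))%Z. rewrite opp_IZR, minus_IZR.
  destruct (archimed (w - x)). lra.
Qed.

Fixpoint action (L : R -> R -> R) (n : nat) (x : nat -> R) : R :=
  match n with
  | O => 0
  | S m => action L m x + L (x m) (x (S m))
  end.

Definition steps (n : nat) (x : nat -> R) : Prop :=
  forall i, (i < n)%nat -> 0 <= x (S i) - x i <= 1.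

Definition chain (p n : nat) (x : nat -> R) : Prop :=
  steps n x /\ x n = x O + INR p.

(** The periodic continuation of a chain to all indices, which lets any vertex be taken as the first
    one. *)
Definition orbit (p n : nat) (x : nat -> R) : Prop :=
  (forall k, 0 <= x (S k) - x k <= 1) /\ (forall k, x (k + n)%nat = x k + INR p).

(** [tw_cross] is the positivity of the mixed second derivative in integrated form and [tw_seq] is
    joint continuity, so the variational argument never differentiates [L]. *)
Record twist (L : R -> R -> R) : Prop := {
  tw_per1 : forall x y, L (x + 1) y = L x y;
  tw_per2 : forall x y, L x (y + 1) = L x y;
  tw_diag : forall x, L x x = 0;
  tw_cross : forall x y y' x', x < y -> y <= y' -> y' < x' -> x' <= x + 1 ->
    L x x' + L y y' < L x y' + L y x';
  (* The discrete Euler-Lagrange equation determines the next point. *)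
  tw_next : forall u v w w', u < v < u + 1 -> v < w -> w < w' -> w' < v + 1 ->
    (forall t, u <= t <= u + 1 -> w - 1 <= t <= w -> L u t + L t w <= L u v + L v w) ->
    (forall t, u <= t <= u + 1 -> w' - 1 <= t <= w' -> L u t + L t w' <= L u v + L v w') ->
    False;
  tw_bounded : exists B, forall x y, L x y <= B;
  tw_seq : forall (x y : nat -> R) (a b : R), is_lim_seq x a -> is_lim_seq y b ->
    is_lim_seq (fun m => L (x m) (y m)) (L a b)
}.

Lemma action_ext L n x y :
  (forall i, (i <= n)%nat -> x i = y i) -> action L n x = action L n y.
Proof.
  induction n as [|n IH]; intros H; simpl; [reflexivity|].
  rewrite IH by (intros; apply H; lia). now rewrite !H by lia.
Qed.

Lemma action_add L n m x :
  action L (n + m) x = action L n x + action L m (fun k => x (n + k)%nat).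
Proof.
  induction m as [|m IH]; simpl.
  - rewrite Nat.add_0_r. lra.
  - rewrite Nat.add_succ_r. simpl. rewrite IH. lra.
Qed.

Lemma action_split L n m x :
  action L (n + 1 + m) x =
  action L n x + L (x n) (x (S n)) + action L m (fun k => x (S n + k)%nat).
Proof.
  rewrite action_add. replace (n + 1)%nat with (S n) by lia. reflexivity.
Qed.

Lemma twist_per_Z L : twist L -> forall (z : Z) x y, L (x + IZR z) (y + IZR z) = L x y.
Proof.
  intros T z x y. rewrite (periodic_Z (L (x + IZR z)) (tw_per2 _ T _)).
  exact (periodic_Z (fun x => L x y) (fun x => tw_per1 _ T x y) z x).
Qed.

Lemma twist_per L : twist L -> forall (n : nat) x y, L (x + INR n) (y + INR n) = L x y.
Proof. intros T n x y. rewrite INR_IZR_INZ. now apply twist_per_Z. Qed.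

Lemma twist_cross_weak L : twist L -> forall x y y' x',
  x <= y -> y <= y' -> y' <= x' -> x' <= x + 1 ->
  L x x' + L y y' <= L x y' + L y x'.
Proof.
  intros T x y y' x' h1 h2 h3 h4.
  destruct (Req_dec x y) as [->|]; [lra|].
  destruct (Req_dec y' x') as [->|]; [lra|].
  apply Rlt_le, (tw_cross _ T); lra.
Qed.

Lemma action_translate L : twist L -> forall N n x,
  action L n (fun k => x k + INR N) = action L n x.
Proof.
  intros T N n x. induction n as [|n IH]; simpl; [reflexivity|].
  now rewrite IH, (twist_per _ T).
Qed.

Lemma orbit_shift p n x s : orbit p n x -> orbit p n (fun k => x (s + k)%nat).
Proof.
  intros [H1 H2]; split; intros k.
  - rewrite Nat.add_succ_r. apply H1.
  - rewrite Nat.add_assoc. apply H2.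
Qed.

Lemma orbit_translate p n x c : orbit p n x -> orbit p n (fun k => x k + c).
Proof.
  intros [H1 H2]; split; intros k.
  - specialize (H1 k). lra.
  - rewrite H2. lra.
Qed.

Lemma orbit_iter p n x : orbit p n x ->
  forall j k, x (k + j * n)%nat = x k + INR j * INR p.
Proof.
  intros [_ H2] j k. induction j as [|j IH].
  - simpl. rewrite Nat.add_0_r. lra.
  - rewrite S_INR. replace (k + S j * n)%nat with (k + j * n + n)%nat by lia.
    rewrite H2, IH. lra.
Qed.

(** A shift by one index drops the first term and appends [L (x n) (x (S n))]; the two agree by
    periodicity. *)
Lemma action_orbit_shift L p n x s : twist L -> orbit p n x ->
  action L n (fun k => x (s + k)%nat) = action L n x.
Proof.
  intros T Ho. revert x Ho. induction s as [|s IH]; intros x Ho; [reflexivity|].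
  change (fun k : nat => x (S s + k)%nat) with (fun k => (fun j => x (1 + j)%nat) (s + k)%nat).
  rewrite IH by now apply orbit_shift.
  assert (E : action L (1 + n) x = action L (n + 1) x) by now rewrite Nat.add_comm.
  rewrite !action_add in E. simpl in E. rewrite Nat.add_0_r, Nat.add_1_r in E.
  destruct Ho as [_ H2]. pose proof (H2 O) as E0. pose proof (H2 1%nat) as E1.
  simpl in E0, E1. rewrite E0, E1, (twist_per _ T) in E. simpl. lra.
Qed.

Definition extend (p n : nat) (x : nat -> R) (k : nat) : R :=
  x (k mod n)%nat + INR (k / n) * INR p.

Lemma extend_eq p n x k : chain p n x -> (1 <= n)%nat -> (k <= n)%nat ->
  extend p n x k = x k.
Proof.
  intros [_ H] Hn Hk. unfold extend.
  destruct (Nat.eq_dec k n) as [->|].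
  - rewrite Nat.Div0.mod_same, Nat.div_same, H by lia. simpl. lra.
  - rewrite Nat.mod_small, Nat.div_small by lia. simpl. lra.
Qed.

Lemma extend_orbit p n x : chain p n x -> (1 <= n)%nat -> orbit p n (extend p n x).
Proof.
  intros C Hn. pose proof C as [H1 H2].
  assert (P : forall k, extend p n x (k + n)%nat = extend p n x k + INR p).
  { intros k. unfold extend.
    replace (k + n)%nat with (k + 1 * n)%nat by lia.
    rewrite Nat.Div0.mod_add, Nat.div_add, plus_INR by lia. simpl. lra. }
  split; [|exact P].
  assert (Q : forall r j, (r < n)%nat ->
    0 <= extend p n x (S (r + j * n)) - extend p n x (r + j * n) <= 1).
  { intros r j Hr. induction j as [|j IH].
    - simpl. rewrite Nat.add_0_r, !extend_eq by (auto; lia). now apply H1.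
    - replace (r + S j * n)%nat with (r + j * n + n)%nat by lia.
      rewrite <- Nat.add_succ_l, !P. lra. }
  intros k. rewrite (Nat.div_mod_eq k n).
  replace (n * (k / n) + k mod n)%nat with (k mod n + (k / n) * n)%nat by lia.
  apply Q. apply Nat.mod_upper_bound; lia.
Qed.

Definition optimal (L : R -> R -> R) (p n : nat) (x : nat -> R) : Prop :=
  orbit p n x /\ forall y, chain p n y -> action L n y <= action L n x.

Lemma extend_optimal L p n x : (1 <= n)%nat -> chain p n x ->
  (forall y, chain p n y -> action L n y <= action L n x) ->
  optimal L p n (extend p n x).
Proof.
  intros Hn C H. split; [now apply extend_orbit|].
  rewrite (action_ext L n (extend p n x) x); [exact H|].
  intros i Hi. now apply extend_eq.
Qed.

Lemma optimal_shift L p n x s : twist L -> optimal L p n x ->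
  optimal L p n (fun k => x (s + k)%nat).
Proof.
  intros T [Ho H]. split; [now apply orbit_shift|].
  intros y C. rewrite (action_orbit_shift _ p) by assumption. now apply H.
Qed.

Lemma optimal_translate L p n x N : twist L -> optimal L p n x ->
  optimal L p n (fun k => x k + INR N).
Proof.
  intros T [Ho H]. split; [now apply orbit_translate|].
  intros y C. rewrite action_translate by assumption. now apply H.
Qed.

(** The bounds on [t] keep both adjacent steps in [[0, 1]], so the sequence with this single vertex
    moved to [t] is a competitor. *)
Lemma optimal_local L p n x s t : twist L -> optimal L p n x -> (2 <= n)%nat ->
  x s <= t <= x s + 1 -> x (S (S s)) - 1 <= t <= x (S (S s)) ->
  L (x s) t + L t (x (S (S s))) <=
  L (x s) (x (S s)) + L (x (S s)) (x (S (S s))).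
Proof.
  intros T Ho Hn h1 h2.
  (* After the shift the moved vertex has index 1, which for [2 <= n] is not an end of the chain, so
     the closing condition is unaffected. *)
  apply (optimal_shift _ _ _ _ s T) in Ho. destruct Ho as [Oz H].
  set (z := fun k => x (s + k)%nat) in *.
  assert (E0 : x s = z O) by (unfold z; now rewrite Nat.add_0_r).
  assert (E1 : x (S s) = z 1%nat) by (unfold z; now rewrite Nat.add_1_r).
  assert (E2 : x (S (S s)) = z 2%nat) by (unfold z; f_equal; lia).
  rewrite E0, E1, E2 in *. clearbody z.
  set (y := fun k => match k with 1%nat => t | _ => z k end).
  assert (C : chain p n y).
  { split.
    - intros [|[|i]] Hi; unfold y; [lra|lra|apply Oz].
    - destruct n as [|[|n]]; [lia|lia|]. unfold y. apply (proj2 Oz O). }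
  specialize (H y C).
  destruct n as [|[|n]]; [lia|lia|].
  change (S (S n)) with (2 + n)%nat in H. rewrite !action_add in H.
  rewrite (action_ext L n (fun k => y (2 + k)%nat) (fun k => z (2 + k)%nat)) in H
    by (intros; reflexivity).
  simpl in H. lra.
Qed.

(** A step of length 0 (or 1) forces the next one to have the same length: otherwise moving their
    common vertex to the midpoint of its neighbours increases the action by [tw_cross]. Over a whole
    period the advance would then be 0 (or [n]) instead of [p]. *)
Lemma optimal_strict_steps L p n x : twist L -> optimal L p n x ->
  (1 <= p)%nat -> (p < n)%nat -> forall k, x k < x (S k) < x k + 1.
Proof.
  intros T Ho Hp Hpn k.
  pose proof (proj1 Ho) as [H1 H2].
  assert (Z : forall i, x (S i) = x i -> x (S (S i)) = x (S i)).
  { intros i E. apply NNPP; intros N. pose proof (H1 i). pose proof (H1 (S i)).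
    set (t := (x i + x (S (S i))) / 2).
    assert (x (S (S i)) > x i) by lra.
    pose proof (optimal_local L p n x i t T Ho ltac:(lia) ltac:(unfold t; split; lra) ltac:(unfold t; split; lra)).
    pose proof (tw_cross _ T (x i) t t (x (S (S i))) ltac:(unfold t; lra) ltac:(lra)
      ltac:(unfold t; lra) ltac:(lra)).
    rewrite E, !(tw_diag _ T) in *. lra. }
  assert (U : forall i, x (S i) = x i + 1 -> x (S (S i)) = x (S i) + 1).
  { intros i E. apply NNPP; intros N. pose proof (H1 i). pose proof (H1 (S i)).
    set (t := (x i + x (S (S i))) / 2).
    assert (x (S (S i)) < x i + 2) by lra.
    pose proof (optimal_local L p n x i t T Ho ltac:(lia) ltac:(unfold t; split; lra) ltac:(unfold t; split; lra)).
    pose proof (tw_cross _ T t (x i + 1) (x (S (S i))) (t + 1) ltac:(unfold t; lra) ltac:(lra)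
      ltac:(unfold t; lra) ltac:(lra)).
    rewrite E, ?(tw_per1 _ T), ?(tw_per2 _ T), ?(tw_diag _ T) in *. lra. }
  pose proof (H1 k). pose proof (H2 k) as E. assert (0 <= INR p) by apply pos_INR. split.
  - apply Rnot_le_lt. intros N.
    assert (A : forall j, x (j + k)%nat = x k /\ x (S (j + k)) = x (j + k)%nat).
    { induction j as [|j [IH1 IH2]]; simpl; [split; lra|]. split; [lra|now apply Z]. }
    destruct (A n) as [A1 _]. rewrite Nat.add_comm in A1.
    apply (lt_INR 0) in Hp. simpl in Hp. lra.
  - apply Rnot_le_lt. intros N.
    assert (A : forall j, x (j + k)%nat = x k + INR j /\ x (S (j + k)) = x (j + k)%nat + 1).
    { induction j as [|j [IH1 IH2]]; [simpl; split; lra|]. rewrite S_INR; simpl. split; [lra|now apply U]. }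
    destruct (A n) as [A1 _]. rewrite Nat.add_comm in A1.
    apply lt_INR in Hpn. lra.
Qed.

(** * Exchanging the tails of two sequences *)

Definition splice (x : nat -> R) (a : nat) (y : nat -> R) (c : nat) (k : nat) : R :=
  if (k <=? a)%nat then x k else y (k - a + c)%nat.

Lemma splice_l x a y c k : (k <= a)%nat -> splice x a y c k = x k.
Proof. intros H. unfold splice. now rewrite (proj2 (Nat.leb_le _ _) H). Qed.

Lemma splice_r x a y c k : splice x a y c (S a + k) = y (S c + k)%nat.
Proof.
  unfold splice. replace (S a + k <=? a)%nat with false.
  - f_equal. lia.
  - symmetry. apply Nat.leb_gt. lia.
Qed.

Lemma steps_splice x a y c e :
  steps a x -> steps (c + 1 + e) y -> 0 <= y (S c) - x a <= 1 ->
  steps (a + 1 + e) (splice x a y c).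
Proof.
  intros Hx Hy H i Hi.
  destruct (Nat.lt_ge_cases i a) as [h|h].
  - rewrite !splice_l by lia. now apply Hx.
  - destruct (Nat.eq_dec i a) as [->|].
    + rewrite (splice_l x a y c a) by lia. pose proof (splice_r x a y c O) as E.
      rewrite !Nat.add_0_r in E. now rewrite E.
    + replace i with (S a + (i - S a))%nat by lia.
      rewrite <- (Nat.add_succ_r (S a)), !splice_r.
      rewrite Nat.add_succ_r. apply Hy. lia.
Qed.

Lemma action_splice L x a y c e :
  action L (a + 1 + e) (splice x a y c) =
  action L a x + L (x a) (y (S c)) + action L e (fun k => y (S c + k)%nat).
Proof.
  rewrite action_split. f_equal; [f_equal|].
  - apply action_ext. intros. now apply splice_l.
  - rewrite (splice_l x a y c a) by lia. pose proof (splice_r x a y c O) as E.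
    rewrite !Nat.add_0_r in E. now rewrite E.
  - apply action_ext. intros. apply splice_r.
Qed.

Lemma steps_prefix n m x : (n <= m)%nat -> steps m x -> steps n x.
Proof. intros H S i Hi. apply S. lia. Qed.

(** Only the two cut edges change: a nested pair, the edge of [y] inside that of [x], becomes a
    crossing pair, and [tw_cross] compares exactly these. *)
Lemma splice_swap L x a e y c f : twist L ->
  steps (a + 1 + e) x -> steps (c + 1 + f) y ->
  x a <= y c -> y (S c) <= x (S a) ->
  steps (a + 1 + f) (splice x a y c) /\ steps (c + 1 + e) (splice y c x a) /\
  action L (a + 1 + e) x + action L (c + 1 + f) y <=
  action L (a + 1 + f) (splice x a y c) + action L (c + 1 + e) (splice y c x a) /\
  (x a < y c -> y (S c) < x (S a) ->
  action L (a + 1 + e) x + action L (c + 1 + f) y <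
  action L (a + 1 + f) (splice x a y c) + action L (c + 1 + e) (splice y c x a)).
Proof.
  intros T Hx Hy h1 h2.
  pose proof (Hx a ltac:(lia)). pose proof (Hy c ltac:(lia)).
  split; [|split; [|split]].
  - apply steps_splice; [eapply steps_prefix; [|exact Hx]; lia|exact Hy|lra].
  - apply steps_splice; [eapply steps_prefix; [|exact Hy]; lia|exact Hx|lra].
  - rewrite !action_splice, !action_split.
    pose proof (twist_cross_weak _ T (x a) (y c) (y (S c)) (x (S a))
      ltac:(lra) ltac:(lra) ltac:(lra) ltac:(lra)). lra.
  - intros. rewrite !action_splice, !action_split.
    pose proof (tw_cross _ T (x a) (y c) (y (S c)) (x (S a))
      ltac:(lra) ltac:(lra) ltac:(lra) ltac:(lra)). lra.
Qed.

(** The normal form of the argument: edge 0 of [x] covers edge 0 of [y], and edge [a] of [x] covers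
    edge [a + 1] of [y]. The first swap keeps the numbers of edges [q - 1] and [q + 1]; the second,
    made with an index offset of one, turns both into [q]. *)
Lemma crossing_lt L p q a b x y m : twist L -> q = (a + 2 + b)%nat ->
  (1 <= p)%nat -> (p < q - 1)%nat ->
  optimal L p (q - 1) x -> optimal L p (q + 1) y ->
  x O <= y O -> y 1%nat < x 1%nat ->
  x a <= y (S a) -> y (S (S a)) < x (S a) ->
  (forall z, chain p q z -> action L q z <= m) ->
  action L (q - 1) x + action L (q + 1) y < 2 * m.
Proof.
  intros T Hq Hp Hpq Ox Oy h0 h1 ha hb Hm.
  pose proof (proj1 Ox) as [X1 X2]. pose proof (proj1 Oy) as [Y1 Y2].
  pose proof (optimal_strict_steps _ _ _ _ T Oy Hp ltac:(lia)) as Ys.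
  set (u := splice y O x O). set (w := splice x O y O).
  assert (u0 : u O = y O) by reflexivity.
  assert (w0 : w O = x O) by reflexivity.
  assert (uS : forall k, u (S k) = x (S k)) by (intros; apply (splice_r y O x O)).
  assert (wS : forall k, w (S k) = y (S k)) by (intros; apply (splice_r x O y O)).
  destruct (splice_swap L x O (a + b) y O (a + b + 2) T) as (Su & Sw & A1 & A2);
    [intros ? _; apply X1 | intros ? _; apply Y1 | lra | lra |].
  fold u in Sw, A1, A2. fold w in Su, A1, A2.
  destruct (splice_swap L u a b w (S a) (b + 1) T) as (SA & SB & B1 & _).
  { replace (a + 1 + b)%nat with (0 + 1 + (a + b))%nat by lia. exact Sw. }
  { replace (S a + 1 + (b + 1))%nat with (0 + 1 + (a + b + 2))%nat by lia. exact Su. }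
  (* For [a = 0] the vertex [u a] is [y 0] and no longer [x 0]. *)
  { rewrite wS. destruct a; [|rewrite uS; exact ha].
    rewrite u0. pose proof (Ys O). lra. }
  { rewrite wS, uS. lra. }
  set (A := splice u a w (S a)) in *. set (B := splice w (S a) u a) in *.
  (* Two swaps restore the original tails: [A] starts at [y 0] and ends along [y], [B] starts at
     [x 0] and ends along [x]. Hence both close up with rotation number [p]. *)
  assert (CA : chain p q A).
  { split.
    - replace q with (a + 1 + (b + 1))%nat by lia. exact SA.
    - replace q with (S a + (b + 1))%nat by lia. unfold A at 1. rewrite splice_r.
      unfold A; rewrite splice_l by lia. rewrite u0.
      rewrite Nat.add_succ_l, wS. rewrite <- (Y2 O). f_equal. lia. }
  assert (CB : chain p q B).
  { split.
    - replace q with (S a + 1 + b)%nat by lia. exact SB.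
    - replace q with (S (S a) + b)%nat by lia. unfold B at 1. rewrite splice_r.
      unfold B; rewrite splice_l by lia. rewrite w0.
      rewrite Nat.add_succ_l, uS. rewrite <- (X2 O). f_equal. lia. }
  pose proof (Hm A CA) as MA. pose proof (Hm B CB) as MB.
  replace (q - 1)%nat with (0 + 1 + (a + b))%nat by lia.
  replace (q + 1)%nat with (0 + 1 + (a + b + 2))%nat by lia.
  replace (S a + 1 + (b + 1))%nat with (0 + 1 + (a + b + 2))%nat in B1 by lia.
  replace (a + 1 + b)%nat with (0 + 1 + (a + b))%nat in B1 by lia.
  replace (a + 1 + (b + 1))%nat with q in B1 by lia.
  replace (S a + 1 + b)%nat with q in B1 by lia.
  (* If [x 0 < y 0], the first swap is already strict. *)
  destruct (Rle_lt_or_eq_dec _ _ h0) as [h|h].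
  { specialize (A2 h h1). lra. }
  apply Rnot_le_lt. intros N.
  (* In case of equality [A] is maximal as well, and follows [y] up to [y 0]
     but leaves it afterwards. *)
  assert (OA : optimal L p q (extend p q A)).
  { apply extend_optimal; [lia|exact CA|]. intros z Cz. specialize (Hm z Cz). lra. }
  set (Z := extend p q A) in *.
  pose proof (optimal_strict_steps _ _ _ _ T OA Hp ltac:(lia)) as Zs.
  (* The tail of [A] is that of [y] with indices lowered by one, so the consecutive vertices [y q],
     [y (S q)] of [y] are also consecutive in [Z]. *)
  assert (Zq1 : Z (q - 1)%nat = y q).
  { unfold Z. rewrite extend_eq by (auto; lia).
    replace (q - 1)%nat with (S a + b)%nat by lia. unfold A. rewrite splice_r.
    rewrite Nat.add_succ_l, wS. f_equal. lia. }
  assert (Z0 : Z O = y O).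
  { unfold Z. rewrite extend_eq by (auto; lia). unfold A. now rewrite splice_l by lia. }
  assert (Zq : Z q = y (S q)).
  { pose proof (proj2 (proj1 OA) O) as E. simpl in E. rewrite E, Z0, <- (Y2 O). f_equal; lia. }
  (* [Z 1] is [y 2] if [a = 0] and [x 1] otherwise. Raised by [p], this separates [Z (S q)] from
     [y (S (S q))]. *)
  assert (Z1 : y 1%nat < Z 1%nat).
  { unfold Z. rewrite extend_eq by (auto; lia). unfold A. destruct a.
    - pose proof (splice_r u O w 1%nat O) as E1. simpl in E1. rewrite E1, wS. apply Ys.
    - rewrite splice_l by lia. now rewrite uS. }
  assert (ZSq : Z (S q) = Z 1%nat + INR p) by apply (proj2 (proj1 OA) 1%nat).
  assert (YSq : y (S (S q)) = y 1%nat + INR p)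
    by (rewrite <- (Y2 1%nat); f_equal; lia).
  apply (tw_next _ T (y q) (y (S q)) (y (S (S q))) (Z (S q))).
  - apply Ys.
  - apply Ys.
  - lra.
  - rewrite <- Zq. apply Zs.
  - intros t t1 t2. apply (optimal_local L p (q + 1) y q t T Oy ltac:(lia)); lra.
  - intros t t1 t2. rewrite <- Zq1, <- Zq.
    pose proof (optimal_local L p q Z (q - 1) t T OA ltac:(lia)) as H.
    replace (S (q - 1)) with q in H by lia. apply H; lra.
Qed.

Lemma last_before (P : nat -> Prop) K : P O -> ~ P K ->
  exists i, (i < K)%nat /\ P i /\ ~ P (S i).
Proof.
  intros H0 HK. induction K as [|K IH]; [contradiction|].
  destruct (classic (P K)) as [h|h].
  - exists K. auto.
  - destruct (IH h) as (i & ? & ? & ?). exists i. repeat split; auto.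
Qed.

(** Integer translation, index shifts and two discrete intermediate value arguments bring [x] and
    [y] into the position required by [crossing_lt]. *)
Lemma optimal_lt L p q x y m : twist L -> (1 <= p)%nat -> (p < q - 1)%nat ->
  optimal L p (q - 1) x -> optimal L p (q + 1) y ->
  (forall z, chain p q z -> action L q z <= m) ->
  action L (q - 1) x + action L (q + 1) y < 2 * m.
Proof.
  intros T Hp Hpq Ox Oy Hm.
  destruct (INR_unbounded (x O - y O)) as [N HN].
  apply (optimal_translate _ _ _ _ N T) in Oy.
  rewrite <- (action_translate L T N (q + 1) y).
  set (y' := fun k => y k + INR N) in *.
  assert (h0 : x O <= y' O) by (unfold y'; lra).
  clearbody y'. clear y HN. rename y' into y.
  assert (Hp' : 1 <= INR p) by (apply (le_INR 1); lia).
  (* The bound is a common multiple [j * (q + 1) * (q - 1)] of both periods, over which [x] gains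
     [2 * j * p] on [y]; this exceeds the initial lead of [y]. *)
  destruct (last_before (fun k => x k <= y k)
    (0 + (Z.to_nat (up (y O - x O)) * (q + 1)) * (q - 1))) as (i & _ & hi & hi'); [exact h0| |].
  { set (j := Z.to_nat (up (y O - x O))).
    assert (Hj : y O - x O < INR j).
    { destruct (archimed (y O - x O)) as [Hu _].
      unfold j. rewrite INR_IZR_INZ, Z2Nat.id; [lra|].
      apply le_IZR. lra. }
    rewrite (orbit_iter _ _ _ (proj1 Ox)).
    replace (0 + j * (q + 1) * (q - 1))%nat with (0 + j * (q - 1) * (q + 1))%nat by lia.
    rewrite (orbit_iter _ _ _ (proj1 Oy)), !mult_INR.
    rewrite plus_INR, minus_INR by lia. simpl.
    pose proof (pos_INR j). nra. }
  rewrite <- (action_orbit_shift L p (q - 1) x i T (proj1 Ox)).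
  rewrite <- (action_orbit_shift L p (q + 1) y i T (proj1 Oy)).
  apply (optimal_shift _ _ _ _ i T) in Ox. apply (optimal_shift _ _ _ _ i T) in Oy.
  set (x' := fun k => x (i + k)%nat) in *. set (y' := fun k => y (i + k)%nat) in *.
  assert (g0 : x' O <= y' O) by (unfold x', y'; now rewrite Nat.add_0_r).
  assert (g1 : y' 1%nat < x' 1%nat) by (unfold x', y'; rewrite Nat.add_1_r; lra).
  clearbody x' y'. clear x y h0 hi hi' i. rename x' into x. rename y' into y.
  pose proof (proj1 Ox) as [X1 X2]. pose proof (proj1 Oy) as [Y1 Y2].
  (* By index [q] the shift of [y] is overtaken: [x q = x 1 + p] exceeds [y 1 + p = y (q + 2)],
     which is at least [y (S q)]. *)
  destruct (last_before (fun k => x k <= y (S k)) q) as (a & Ha & ha & ha').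
  { pose proof (Y1 O). lra. }
  { replace q with (1 + (q - 1))%nat at 1 by lia. rewrite X2.
    pose proof (Y2 1%nat) as E. replace (1 + (q + 1))%nat with (S (S q)) in E by lia.
    pose proof (Y1 (S q)). lra. }
  destruct (Nat.eq_dec a (q - 1)) as [->|Na].
  (* Here edge [q - 1] of [x] is edge 0 translated by [p], so both coverings occur on the same edge
     of [x]. Reading [y] from index [q] interchanges their order and gives the normal form with
     [a = 0]. *)
  - pose proof (X2 O) as E. simpl in E. replace (S (q - 1)) with q in * by lia.
    set (y' := fun k => y (q + k)%nat).
    assert (yS : forall k, y' (S k) = y k + INR p).
    { intros k. unfold y'. rewrite <- Y2. f_equal. lia. }
    rewrite <- (action_orbit_shift L p (q + 1) y q T (proj1 Oy)).
    rewrite <- (action_translate L T p (q - 1) x).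
    assert (Oy' : optimal L p (q + 1) y') by now apply optimal_shift.
    assert (Ox' : optimal L p (q - 1) (fun k => x k + INR p)) by now apply optimal_translate.
    fold y'. pose proof (Y1 O).
    apply (crossing_lt L p q O (q - 2)); auto; rewrite ?yS; try lra; try lia.
    unfold y'. rewrite Nat.add_0_r. lra.
  - apply (crossing_lt L p q a (q - 2 - a)); auto; try lia. lra.
Qed.

(** * Existence of maximal chains by compactness *)

Lemma is_lim_seq_inv_S : is_lim_seq (fun n => / INR (S n)) 0.
Proof.
  apply (is_lim_seq_incr_1 (fun n => / INR n)).
  apply (is_lim_seq_inv INR p_infty); [apply is_lim_seq_INR|discriminate].
Qed.

(** [Bolzano_Weierstrass] provides a cluster value only; the subsequence is built by choosing,
    beyond the previous index, a term within [/ INR (S n)] of it. *)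
Lemma Bolzano_Weierstrass_subseq (u : nat -> R) a b : (forall n, a <= u n <= b) ->
  exists phi : nat -> nat, (forall n, (phi n < phi (S n))%nat) /\
  exists l : R, is_lim_seq (fun n => u (phi n)) l.
Proof.
  intros Hu.
  destruct (Bolzano_Weierstrass u (fun t => a <= t <= b) (compact_P3 a b) Hu) as [l Hl].
  assert (C : forall N k : nat, exists j, (N < j)%nat /\ Rabs (u j - l) < / INR (S k)).
  { intros N k.
    assert (P : 0 < / INR (S k)) by (apply Rinv_0_lt_compat, lt_0_INR; lia).
    destruct (Hl (disc l (mkposreal _ P)) (S N)) as (j & Hj & Hd).
    - exists (mkposreal _ P). intros t; auto.
    - exists j. split; [lia|exact Hd]. }
  assert (C' : forall Nk : nat * nat, exists j, (fst Nk < j)%nat /\ Rabs (u j - l) < / INR (S (snd Nk)))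
    by (intros [N k]; apply C).
  apply functional_choice in C'. destruct C' as [f Hf].
  set (phi := fix phi n := match n with O => f (O, O) | S k => f (phi k, S k) end).
  exists phi. split.
  - intros n. apply (Hf (phi n, S n)).
  - exists l.
    assert (B : forall n, Rabs (u (phi n) - l) < / INR (S n)).
    { intros [|n]; [apply (Hf (O, O))|apply (Hf (phi n, S n))]. }
    apply is_lim_seq_le_le with (u := fun n => l - / INR (S n)) (w := fun n => l + / INR (S n)).
    + intros n. specialize (B n). apply Rabs_def2 in B. lra.
    + replace (Finite l) with (Finite (l - 0)) by (f_equal; lra).
      apply is_lim_seq_minus'; [apply is_lim_seq_const|exact is_lim_seq_inv_S].
    + replace (Finite l) with (Finite (l + 0)) by (f_equal; lra).
      apply is_lim_seq_plus'; [apply is_lim_seq_const|exact is_lim_seq_inv_S].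
Qed.

Lemma bounded_subseq (k : nat) (x : nat -> nat -> R) a b :
  (forall m i, (i < k)%nat -> a <= x m i <= b) ->
  exists phi : nat -> nat, (forall n, (phi n < phi (S n))%nat) /\
  exists l : nat -> R, forall i, (i < k)%nat -> is_lim_seq (fun m => x (phi m) i) (l i).
Proof.
  induction k as [|k IH]; intros H.
  - exists (fun n => n). split; [auto|]. exists (fun _ => 0). lia.
  - destruct IH as (phi & Hphi & l & Hl); [intros; apply H; lia|].
    destruct (Bolzano_Weierstrass_subseq (fun m => x (phi m) k) a b) as (psi & Hpsi & l' & Hl').
    { intros; apply H; lia. }
    exists (fun n => phi (psi n)). split.
    + intros n. assert (M : forall i j, (i < j)%nat -> (phi i < phi j)%nat).
      { intros i j Hij. induction Hij; [apply Hphi|]. specialize (Hphi m). lia. }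
      apply M, Hpsi.
    + exists (fun i => if (i <? k)%nat then l i else l'). intros i Hi.
      destruct (Nat.ltb_spec i k) as [h|h].
      * apply (is_lim_seq_subseq (fun m => x (phi m) i)); [|now apply Hl].
        now apply eventually_subseq.
      * replace i with k by lia. exact Hl'.
Qed.

Lemma is_lim_seq_action L n (x : nat -> nat -> R) (l : nat -> R) : twist L ->
  (forall i, (i <= n)%nat -> is_lim_seq (fun m => x m i) (l i)) ->
  is_lim_seq (fun m => action L n (x m)) (action L n l).
Proof.
  intros T. induction n as [|n IH]; intros H; simpl.
  - apply is_lim_seq_const.
  - apply is_lim_seq_plus'; [apply IH; intros; apply H; lia|].
    apply (tw_seq _ T); apply H; lia.
Qed.

Lemma steps_bounds n x : steps n x -> forall i, (i <= n)%nat -> x O <= x i <= x O + INR i.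
Proof.
  intros H i. induction i as [|i IH]; intros Hi.
  - simpl. lra.
  - specialize (IH ltac:(lia)). specialize (H i ltac:(lia)). rewrite S_INR. lra.
Qed.

(** Integer translations preserve the action; this confines the vertices of a maximizing sequence to
    a compact interval. *)
Lemma chain_normalize L p n x : twist L -> chain p n x ->
  exists y, chain p n y /\ action L n y = action L n x /\ 0 <= y O <= 1.
Proof.
  intros T [H1 H2]. destruct (translate_into_period 0 (x O)) as [z Hz].
  exists (fun k => x k + IZR z). split; [|split].
  - split; [intros i Hi; specialize (H1 i Hi); lra|]. rewrite H2. lra.
  - clear H1 H2. induction n as [|n IH]; simpl; [reflexivity|]. now rewrite IH, twist_per_Z.
  - lra.
Qed.

(** A limit of normalized, nearly maximal chains: the constraints on the steps and the closing
    condition are closed, and the action is continuous. *)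
Lemma maximal_chain L p n : twist L -> (1 <= p)%nat -> (p < n)%nat ->
  exists x, chain p n x /\ forall y, chain p n y -> action L n y <= action L n x.
Proof.
  intros T Hp Hpn. destruct (tw_bounded _ T) as [B HB].
  set (E := fun v => exists x, chain p n x /\ v = action L n x).
  destruct (completeness E) as [s [s1 s2]].
  { exists (INR n * B). intros v (x & _ & ->). clear Hpn E.
    induction n as [|k IH]; [simpl; lra|]. rewrite S_INR. simpl action.
    specialize (HB (x k) (x (S k))). lra. }
  (* The chain with equal steps [p / n] shows that some chain exists. *)
  { eexists. exists (fun k => INR k * (INR p / INR n)). split; [|reflexivity].
    assert (0 < INR n) by (apply lt_0_INR; lia).
    assert (INR p < INR n) by now apply lt_INR.
    assert (0 <= INR p) by apply pos_INR.
    split.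
    - intros i _. rewrite S_INR.
      replace ((INR i + 1) * (INR p / INR n) - INR i * (INR p / INR n)) with (INR p / INR n) by ring.
      split; [apply Rmult_le_pos; [lra|left; now apply Rinv_0_lt_compat]|].
      apply Rmult_le_reg_r with (INR n); [lra|]. field_simplify; lra.
    - simpl. field. lra. }
  assert (C : forall m : nat, exists x, chain p n x /\ 0 <= x O <= 1 /\
      s - / INR (S m) <= action L n x).
  { intros m. assert (P : 0 < / INR (S m)) by (apply Rinv_0_lt_compat, lt_0_INR; lia).
    apply NNPP. intros N. assert (s <= s - / INR (S m)); [|lra].
    apply s2. intros v (x & Cx & ->). apply Rnot_lt_le. intros h.
    destruct (chain_normalize L p n x T Cx) as (y & Cy & Ey & y0).
    apply N. exists y. split; [exact Cy|split; [exact y0|lra]]. }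
  apply functional_choice in C. destruct C as [x Hx].
  destruct (bounded_subseq (S n) x 0 (1 + INR n)) as (phi & Hphi & l & Hl).
  { intros m i Hi. destruct (Hx m) as ([Hs _] & h0 & _).
    pose proof (steps_bounds _ _ Hs i ltac:(lia)).
    pose proof (le_INR i n ltac:(lia)). lra. }
  exists l. split; [split|].
  - intros i Hi.
    assert (D : is_lim_seq (fun m => x (phi m) (S i) - x (phi m) i) (l (S i) - l i))
      by (apply is_lim_seq_minus'; apply Hl; lia).
    split.
    + refine (is_lim_seq_le (fun _ => 0) _ 0 (Finite _) _ (is_lim_seq_const _) D).
      intros m. apply (proj1 (proj1 (Hx (phi m)))), Hi.
    + refine (is_lim_seq_le _ (fun _ => 1) (Finite _) 1 _ D (is_lim_seq_const _)).
      intros m. apply (proj1 (proj1 (Hx (phi m)))), Hi.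
  - assert (D : is_lim_seq (fun m => x (phi m) n) (l O + INR p)).
    { apply is_lim_seq_ext with (fun m => x (phi m) O + INR p).
      - intros m. symmetry. apply (proj1 (Hx (phi m))).
      - apply is_lim_seq_plus'; [apply Hl; lia|apply is_lim_seq_const]. }
    apply is_lim_seq_unique in D.
    rewrite (is_lim_seq_unique _ _ (Hl n ltac:(lia))) in D. now injection D.
  - assert (D : s <= action L n l).
    { refine (is_lim_seq_le (fun m => s - / INR (S (phi m))) _ (Finite s) (Finite _) _ _
        (is_lim_seq_action L n (fun m => x (phi m)) l T _)).
      - intros m. apply Hx.
      - apply (is_lim_seq_subseq (fun m => s - / INR (S m)) s phi).
        + now apply eventually_subseq.
        + replace (Finite s) with (Finite (s - 0)) by (f_equal; lra).
          apply is_lim_seq_minus'; [apply is_lim_seq_const|exact is_lim_seq_inv_S].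
      - intros i Hi. apply Hl. lia. }
    intros y Cy. apply Rle_trans with s; [|exact D]. apply s1. now exists y.
Qed.

Lemma action_max_concave L p q x y z : twist L -> (1 <= p)%nat -> (p < q - 1)%nat ->
  chain p (q - 1) x -> (forall c, chain p (q - 1) c -> action L (q - 1) c <= action L (q - 1) x) ->
  chain p (q + 1) y -> (forall c, chain p (q + 1) c -> action L (q + 1) c <= action L (q + 1) y) ->
  (forall c, chain p q c -> action L q c <= action L q z) ->
  action L (q - 1) x + action L (q + 1) y < 2 * action L q z.
Proof.
  intros T Hp Hpq Cx Mx Cy My Mz.
  rewrite <- (action_ext L (q - 1) (extend p (q - 1) x) x)
    by (intros; apply extend_eq; auto; lia).
  rewrite <- (action_ext L (q + 1) (extend p (q + 1) y) y)
    by (intros; apply extend_eq; auto; lia).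
  apply (optimal_lt L p q); auto; apply extend_optimal; auto; lia.
Qed.

(** * The tangent circle lemma *)

Lemma is_derive_continuity_pt f x l : is_derive f x l -> continuity_pt f x.
Proof.
  intros H. apply derivable_continuous_pt. exists l. now apply is_derive_Reals.
Qed.

(** The derivative is asked for only inside the interval because side values get differentiated only
    away from degenerate sides, which may occur at its ends. *)
Lemma is_derive_lt (f df : R -> R) a b : a < b ->
  (forall c, a < c < b -> is_derive f c (df c)) ->
  (forall c, a <= c <= b -> continuity_pt f c) ->
  (forall c, a < c < b -> 0 < df c) -> f a < f b.
Proof.
  intros Hab Hd Hc Hp.
  assert (pr : forall c, a < c < b -> derivable_pt f c).
  { intros c h. exists (df c). apply is_derive_Reals. now apply Hd. }
  destruct (MVT f id a b pr (fun c _ => derivable_pt_id c) Hab Hc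
    (fun c _ => derivable_continuous_pt _ _ (derivable_pt_id c))) as (c & P & E).
  rewrite derive_pt_id in E. unfold id in E.
  rewrite (derive_pt_eq_0 _ _ _ (pr c P)
    (proj1 (is_derive_Reals _ _ _) (Hd c P))) in E.
  specialize (Hp c P). nra.
Qed.

Lemma critical_of_max (f : R -> R) l a b c : a < c < b -> is_derive f c l ->
  (forall t, a < t < b -> f t <= f c) -> l = 0.
Proof.
  intros Hc Hd Hm. apply is_derive_Reals in Hd.
  pose proof (deriv_maximum f a b c (exist _ l Hd) ltac:(lra) ltac:(lra)
    ltac:(intros; apply Hm; lra)) as E.
  exact E.
Qed.

(** Just after [s] the factor [z], hence the derivative of [f], is negative. Splitting off the
    positive factor [w] avoids differentiating [w]. *)
Lemma decrease_after_critical (f w z : R -> R) s l b : s < b ->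
  (forall t, is_derive f t (w t * z t)) -> (forall t, 0 < w t) ->
  is_derive z s l -> l < 0 -> z s = 0 ->
  exists t, s < t < b /\ f t < f s.
Proof.
  intros Hb Hf Hw Hz Hl Hs.
  apply is_derive_Reals in Hz.
  destruct (Hz (- l / 2) ltac:(lra)) as [d Hd].
  pose proof (cond_pos d).
  set (h := Rmin d (b - s) / 2).
  assert (Hh : 0 < h /\ h < d /\ h < b - s).
  { unfold h. pose proof (Rmin_l d (b - s)). pose proof (Rmin_r d (b - s)).
    assert (0 < Rmin d (b - s)) by (apply Rmin_pos; lra). lra. }
  exists (s + h). split; [lra|].
  apply Ropp_lt_cancel.
  apply (is_derive_lt (fun t => - f t) (fun t => w t * - z t) s (s + h)); [lra| | |].
  - intros c _. replace (w c * - z c) with (- (w c * z c)) by ring.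
    exact (is_derive_opp f c _ (Hf c)).
  - intros c _. apply (is_derive_continuity_pt _ _ (- (w c * z c))).
    exact (is_derive_opp f c _ (Hf c)).
  - intros c Hc. apply Rmult_lt_0_compat; [apply Hw|].
    specialize (Hd (c - s) ltac:(lra) ltac:(rewrite Rabs_right; lra)).
    replace (s + (c - s)) with c in Hd by ring.
    rewrite Hs, Rminus_0_r in Hd.
    assert (E : z c = z c / (c - s) * (c - s)) by (field; lra).
    apply Rabs_def2 in Hd. rewrite E. nra.
Qed.

(* A function all of whose nonpositive critical points are strict local maxima
   cannot have a nonpositive interior minimum. *)
Lemma pos_between (f w z dz : R -> R) a b : a < b -> f a = 0 -> f b = 0 ->
  (forall t, is_derive f t (w t * z t)) -> (forall t, 0 < w t) ->
  (forall t, is_derive z t (dz t)) ->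
  (forall t, a < t < b -> z t = 0 -> f t <= 0 -> dz t < 0) ->
  forall t, a < t < b -> 0 < f t.
Proof.
  intros Hab Ha Hb Hf Hw Hz Hc t Ht. apply Rnot_le_lt. intros N.
  assert (Cf : forall c, continuity_pt f c)
    by (intros c; eapply is_derive_continuity_pt, Hf).
  assert (Q : exists m, a < m < b /\ (forall c, a <= c <= b -> f m <= f c)).
  { destruct (continuity_ab_min f a b ltac:(lra) ltac:(auto)) as (m & Hm & Im).
    destruct (Req_dec (f m) 0) as [E|E].
    (* When the minimum is 0, [t] itself attains it; otherwise the minimum is negative and so not at
       an end. *)
    - exists t. split; [exact Ht|]. intros c Ic. specialize (Hm c Ic). lra.
    - exists m. split; [|exact Hm]. destruct (Req_dec m a); [congruence|].
      destruct (Req_dec m b); [congruence|]. lra. }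
  destruct Q as (m & Im & Hm).
  assert (Z : z m = 0).
  { assert (pr : derivable_pt f m) by (eexists; apply is_derive_Reals, Hf).
    pose proof (deriv_minimum f a b m pr ltac:(lra) ltac:(lra)
      ltac:(intros; apply Hm; lra)) as E.
    rewrite (derive_pt_eq_0 _ _ _ pr (proj1 (is_derive_Reals _ _ _) (Hf m))) in E.
    specialize (Hw m). nra. }
  destruct (decrease_after_critical f w z m (dz m) b) as (s & Hs & Hlt); auto.
  - lra.
  - apply Hc; auto. specialize (Hm t ltac:(lra)). lra.
  - specialize (Hm s ltac:(lra)). lra.
Qed.

Ltac derive_value H :=
  lazymatch type of H with
  | is_derive ?f ?x ?l => replace (Derive (fun y : R => f y) x) with l
      by (symmetry; exact (is_derive_unique f x l H))
  end.

(* [sp] is the speed and [ka] the angular velocity of the unit tangent [(tx, ty)]. *)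
Record frenet (r : R) (u v tx ty sp ka : R -> R) : Prop := {
  fr_u : forall t, is_derive u t (sp t * tx t);
  fr_v : forall t, is_derive v t (sp t * ty t);
  fr_tx : forall t, is_derive tx t (- (ka t * ty t));
  fr_ty : forall t, is_derive ty t (ka t * tx t);
  fr_unit : forall t, tx t * tx t + ty t * ty t = 1;
  fr_sp : forall t, 0 < sp t;
  fr_ka : forall t, sp t < r * ka t;
  fr_r : 0 < r;
  fr_u1 : forall t, u (t + 1) = u t;
  fr_v1 : forall t, v (t + 1) = v t;
  fr_tx1 : forall t, tx (t + 1) = tx t;
  fr_ty1 : forall t, ty (t + 1) = ty t;
  fr_left : forall s t, s < t < s + 1 -> 0 < tx s * (v t - v s) - ty s * (u t - u s)
}.

Section Frenet.

Context {r : R} {u v tx ty sp ka : R -> R} (F : frenet r u v tx ty sp ka).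

Lemma frenet_ka_pos t : 0 < ka t.
Proof.
  pose proof (fr_sp _ _ _ _ _ _ _ F t). pose proof (fr_ka _ _ _ _ _ _ _ F t).
  pose proof (fr_r _ _ _ _ _ _ _ F). nra.
Qed.

(* [r] minus the support function at [t], with respect to the center of the circle
   tangent to the curve at [s]. *)
Lemma frenet_support t s : t < s < t + 1 ->
  0 < r * (1 - (tx s * tx t + ty s * ty t)) + ((v t - v s) * tx t - (u t - u s) * ty t).
Proof.
  destruct F as [Fu Fv Ftx Fty Fn Fs Fk Fr u1 v1 tx1 ty1 Fl].
  apply (pos_between
    (fun s => r * (1 - (tx s * tx t + ty s * ty t)) + ((v t - v s) * tx t - (u t - u s) * ty t))
    (fun s => r * ka s - sp s) (fun s => tx t * ty s - ty t * tx s)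
    (fun s => ka s * (tx t * tx s + ty t * ty s))); clear s.
  - lra.
  - rewrite Fn. ring.
  - rewrite u1, v1, tx1, ty1, Fn. ring.
  - intros s. auto_derive.
    + repeat split; eexists; eauto.
    + derive_value (Fu s); derive_value (Fv s); derive_value (Ftx s); derive_value (Fty s); ring.
  - intros s. specialize (Fk s). lra.
  - intros s. auto_derive.
    + repeat split; eexists; eauto.
    + derive_value (Ftx s); derive_value (Fty s); ring.
  (* At a critical point the tangents at [s] and [t] are parallel. Equal directions are impossible,
     since each point would lie strictly to the left of the tangent at the other; opposite ones make
     the second derivative factor negative. *)
  - intros s Hs Z _. pose proof (frenet_ka_pos s) as Kp.
    set (c := tx t * tx s + ty t * ty s).
    assert (C : c * c = 1).
    { transitivity ((tx t * tx t + ty t * ty t) * (tx s * tx s + ty s * ty s)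
        - (tx t * ty s - ty t * tx s) * (tx t * ty s - ty t * tx s)).
      - unfold c. ring.
      - rewrite !Fn, Z. ring. }
    destruct (Rlt_le_dec c 0) as [h|h]; [nra|exfalso].
    assert (c1 : c = 1) by nra.
    assert (S : (tx s - tx t) * (tx s - tx t) + (ty s - ty t) * (ty s - ty t) = 0).
    { transitivity ((tx t * tx t + ty t * ty t) + (tx s * tx s + ty s * ty s) - 2 * c).
      - unfold c. ring.
      - rewrite !Fn, c1. ring. }
    apply Rplus_sqr_eq_0 in S. destruct S as [E1 E2].
    apply Rminus_diag_uniq in E1, E2.
    pose proof (Fl t s Hs) as P1. pose proof (Fl s (t + 1) ltac:(lra)) as P2.
    rewrite u1, v1, E1, E2 in P2. lra.
Qed.

(** This is Blaschke's theorem: expanded around the point at [t], the inequality says that the point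
    at [s] lies strictly inside the circle of radius [r] tangent at [t]. The difference of the two
    sides is [r * r] minus the squared distance to the center, to which [pos_between] applies. *)
Lemma frenet_disc t s : t < s < t + 1 ->
  (u s - u t) * (u s - u t) + (v s - v t) * (v s - v t) <
  2 * r * (tx t * (v s - v t) - ty t * (u s - u t)).
Proof.
  intros Hs. apply Rlt_0_minus. revert s Hs.
  pose proof frenet_support as Hsup.
  destruct F as [Fu Fv Ftx Fty Fn Fs Fk Fr u1 v1 tx1 ty1 Fl].
  apply (pos_between
    (fun s => 2 * r * (tx t * (v s - v t) - ty t * (u s - u t)) -
      ((u s - u t) * (u s - u t) + (v s - v t) * (v s - v t)))
    (fun s => 2 * sp s)
    (fun s => r * (tx t * ty s - ty t * tx s) - (u s - u t) * tx s - (v s - v t) * ty s)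
    (fun s => r * ka s * (tx t * tx s + ty t * ty s) - sp s * (tx s * tx s + ty s * ty s)
      - ka s * ((v s - v t) * tx s - (u s - u t) * ty s))).
  - lra.
  - ring.
  - rewrite u1, v1. ring.
  - intros s. auto_derive.
    + repeat split; eexists; eauto.
    + derive_value (Fu s); derive_value (Fv s); ring.
  - intros s. specialize (Fs s). lra.
  - intros s. auto_derive.
    + repeat split; eexists; eauto.
    + derive_value (Fu s); derive_value (Fv s); derive_value (Ftx s); derive_value (Fty s); ring.
  - intros s Hs Z N. pose proof (frenet_ka_pos s) as Kp.
    (* [m] is the left normal component, at [s], of the vector from the center to the curve. At a
       critical point this vector is normal, so being outside gives [r * r <= m * m];
       [frenet_support] rules out [m <= - r]. *)
    set (m := (v s - v t) * tx s - (u s - u t) * ty s - r * (tx t * tx s + ty t * ty s)).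
    assert (M : - r < m).
    { pose proof (Hsup s (t + 1) ltac:(lra)) as P.
      rewrite u1, v1, tx1, ty1 in P. unfold m. lra. }
    assert (Q : r * r <= m * m).
    { assert (E : m * m + (r * (tx t * ty s - ty t * tx s) - (u s - u t) * tx s - (v s - v t) * ty s) *
         (r * (tx t * ty s - ty t * tx s) - (u s - u t) * tx s - (v s - v t) * ty s) =
         (tx s * tx s + ty s * ty s) *
         (r * r * (tx t * tx t + ty t * ty t) - (2 * r * (tx t * (v s - v t) - ty t * (u s - u t)) -
      ((u s - u t) * (u s - u t) + (v s - v t) * (v s - v t))))) by (unfold m; ring).
      rewrite Z, !Fn in E. lra. }
    assert (r <= m) by nra.
    rewrite Fn. specialize (Fs s).
    assert (0 < ka s * m) by (apply Rmult_lt_0_compat; lra).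
    unfold m in *. nra.
Qed.

Lemma frenet_disc_end t s : t < s < t + 1 ->
  (u s - u t) * (u s - u t) + (v s - v t) * (v s - v t) <
  2 * r * ((u s - u t) * ty s - (v s - v t) * tx s).
Proof.
  intros H. pose proof (frenet_disc s (t + 1) ltac:(lra)) as P.
  rewrite (fr_u1 _ _ _ _ _ _ _ F), (fr_v1 _ _ _ _ _ _ _ F) in P. lra.
Qed.

End Frenet.

(** * The value of an arc as a function of its end points *)

(* [chord_value r D] is [r / 2 * (d + sin d)], where [d] is the angle subtended
   by a chord with square length [D] in a circle of radius [r]. *)
Definition chord_value (r D : R) : R :=
  r * (asin (sqrt D / (2 * r)) + sqrt D / (2 * r) * sqrt (1 - (sqrt D / (2 * r))²)).

(** Twice the derivative of [chord_value r]: with [sin a = sqrt D / (2 * r)] it is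
    [cos a / sqrt D]. *)
Definition chord_slope (r D : R) : R := sqrt (/ D - / (4 * r * r)).

Lemma half_chord_bounds r D : 0 < r -> D < 4 * r * r -> 0 <= sqrt D / (2 * r) < 1.
Proof.
  intros Hr HD. pose proof (sqrt_pos D). split.
  - apply Rmult_le_pos; [lra|]. left. apply Rinv_0_lt_compat. lra.
  - apply Rmult_lt_reg_r with (2 * r); [lra|]. unfold Rdiv. rewrite Rmult_assoc, Rinv_l, Rmult_1_r by lra.
    destruct (Rle_lt_dec 0 D) as [h|h].
    + apply Rsqr_incrst_0; [|lra|lra]. rewrite Rsqr_sqrt by lra. unfold Rsqr. lra.
    + rewrite sqrt_neg_0 by lra. lra.
Qed.

Lemma is_derive_asin x : -1 < x < 1 -> is_derive asin x (/ sqrt (1 - x²)).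
Proof.
  intros H. apply is_derive_Reals.
  apply (derive_pt_eq_1 _ _ _ (derivable_pt_asin x H)).
  rewrite derive_pt_asin. unfold Rdiv. ring.
Qed.

Lemma chord_value_continuous r D : 0 < r -> D < 4 * r * r ->
  continuity_pt (chord_value r) D.
Proof.
  intros Hr HD. pose proof (half_chord_bounds r D Hr HD) as Hs.
  assert (Hs' : -1 < sqrt D / (2 * r) < 1) by lra.
  assert (Cs : continuity_pt (fun D => sqrt D / (2 * r)) D).
  { apply continuity_pt_mult; [|apply continuity_pt_const; intros ? ?; reflexivity].
    apply continuity_pt_filterlim, (continuous_sqrt D). }
  unfold chord_value.
  apply continuity_pt_mult; [apply continuity_pt_const; intros ? ?; reflexivity|].
  apply continuity_pt_plus.
  - apply (continuity_pt_comp (fun D => sqrt D / (2 * r)) asin); [exact Cs|].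
    apply (is_derive_continuity_pt _ _ _ (is_derive_asin _ Hs')).
  - apply continuity_pt_mult; [exact Cs|].
    apply (continuity_pt_comp (fun D => 1 - (sqrt D / (2 * r))²) sqrt).
    + apply continuity_pt_minus; [apply continuity_pt_const; intros ? ?; reflexivity|].
      apply continuity_pt_mult; exact Cs.
    + apply continuity_pt_filterlim. apply (continuous_sqrt _).
Qed.

Lemma chord_value_derive r D : 0 < r -> 0 < D < 4 * r * r ->
  is_derive (chord_value r) D (chord_slope r D / 2).
Proof.
  intros Hr HD. pose proof (half_chord_bounds r D Hr (proj2 HD)) as Hs.
  assert (HD0 : 0 < sqrt D) by (apply sqrt_lt_R0; lra).
  assert (Hs' : -1 < sqrt D / (2 * r) < 1) by lra.
  pose proof (is_derive_asin _ Hs') as Ha.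
  assert (Hc : 0 < 1 - (sqrt D / (2 * r))²)
    by (revert Hs; generalize (sqrt D / (2 * r)); intros s Hs; unfold Rsqr; nra).
  unfold chord_value. auto_derive.
  - repeat split; try lra; try (eexists; exact Ha).
  - set (s := sqrt D / (2 * r)) in *.
    assert (ED : sqrt D = s * (2 * r)) by (unfold s; field; lra).
    change (sqrt D * / (2 * r)) with s. derive_value Ha.
    assert (EK : chord_slope r D = sqrt (1 - s²) / sqrt D).
    { unfold chord_slope. rewrite <- sqrt_div_alt by lra. f_equal.
      unfold s, Rdiv. rewrite Rsqr_mult, Rsqr_sqrt by lra. unfold Rsqr. field. lra. }
    rewrite EK.
    assert (Hq : 0 < sqrt (1 - s²)) by now apply sqrt_lt_R0.
    assert (Q2 : sqrt (1 - s²) * sqrt (1 - s²) = 1 - s * s) by (rewrite sqrt_sqrt; unfold Rsqr in *; lra).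
    change (1 + - s²) with (1 - s²). set (q := sqrt (1 - s²)) in *.
    rewrite ED in *. assert (s <> 0) by (intros Z; rewrite Z in HD0; lra).
    clearbody q s. field_simplify_eq; [|repeat split; lra].
    replace (s ^ 2) with (1 - q * q) by lra. ring.
Qed.

Lemma sqrt_0_1_bound s : 0 <= s <= 1 -> s * sqrt (1 - s²) <= 1.
Proof.
  intros H. assert (sqrt (1 - s²) <= 1).
  { rewrite <- sqrt_1 at 2. apply sqrt_le_1_alt. unfold Rsqr. nra. }
  pose proof (sqrt_pos (1 - s²)). nra.
Qed.

(* For the unit vector [(cx, cy)] at angle [phi] from a vector of square length
   [D], the hypothesis reads [sin a < sin phi], with [sin a = sqrt D / (2 * r)],
   and the conclusion [0 < sin (phi - a)]. *)
Lemma chord_angle_pos r cx cy a b : 0 < r -> cx * cx + cy * cy = 1 ->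
  let D := a * a + b * b in
  D < 2 * r * (cx * b - cy * a) ->
  0 < chord_slope r D * (cx * b - cy * a) - (cx * a + cy * b) / (2 * r).
Proof.
  intros Hr Hn D HD. set (Q := cx * b - cy * a) in *. set (P := cx * a + cy * b).
  assert (E : P * P + Q * Q = D).
  { transitivity ((cx * cx + cy * cy) * D); [unfold P, Q, D; ring|]. rewrite Hn. ring. }
  assert (D0 : 0 <= D) by (unfold D; nra).
  assert (Q0 : 0 < Q) by nra.
  assert (D1 : 0 < D) by nra.
  assert (D4 : D * D < 4 * r * r * (Q * Q)) by nra.
  assert (HK : / D - / (4 * r * r) = (4 * r * r - D) / (4 * r * r * D)) by (field; lra).
  assert (K0 : 0 < / D - / (4 * r * r)).
  { rewrite HK. apply Rdiv_lt_0_compat; nra. }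
  unfold chord_slope. set (K := sqrt (/ D - / (4 * r * r))).
  assert (Kp : 0 < K) by now apply sqrt_lt_R0.
  assert (K2 : K * K = / D - / (4 * r * r)) by (apply sqrt_sqrt; lra).
  apply Rlt_0_minus.
  apply Rmult_lt_reg_r with (2 * r); [lra|].
  unfold Rdiv. rewrite Rmult_assoc, Rinv_l, Rmult_1_r by lra.
  destruct (Rle_lt_dec P 0) as [h|h].
  { apply Rle_lt_trans with 0; [exact h|]. repeat apply Rmult_lt_0_compat; lra. }
  assert (0 < K * Q * (2 * r)) by (repeat apply Rmult_lt_0_compat; lra).
  apply Rsqr_incrst_0; [|lra|lra]. unfold Rsqr.
  replace (K * Q * (2 * r) * (K * Q * (2 * r))) with (K * K * (Q * Q * 4 * r * r)) by ring.
  rewrite K2. replace (P * P) with (D - Q * Q) by lra.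
  apply Rmult_lt_reg_r with D; [lra|].
  replace ((/ D - / (4 * r * r)) * (Q * Q * 4 * r * r) * D)
    with (4 * r * r * (Q * Q) - Q * Q * D) by (field; lra).
  lra.
Qed.

Definition sqdist (u v : R -> R) (x w : R) : R :=
  (u w - u x) * (u w - u x) + (v w - v x) * (v w - v x).

(** An arc of angle [d] has length [r * d], and its area integral is the signed triangle spanned
    with the origin plus the circular segment [r * r / 2 * (d - sin d)]. Length minus area over [r]
    gives this formula. *)
Definition arc_value (r : R) (u v : R -> R) (x w : R) : R :=
  chord_value r (sqdist u v x w) - / (2 * r) * (u x * v w - v x * u w).

(* The cosine of the angle at [x] between the curve and the arc from [x] to [w]. *)
Definition departure_cos (r : R) (u v tx ty : R -> R) (x w : R) : R :=
  chord_slope r (sqdist u v x w) * (tx x * (u w - u x) + ty x * (v w - v x))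
  + / (2 * r) * (tx x * (v w - v x) - ty x * (u w - u x)).

(* In terms of angles this is
   [sin(p - a) sin(q - a) = sin a ^ 2 cos p cos q - sin a cos a sin(p + q)
     + cos a ^ 2 sin p sin q]. *)
Lemma departure_cos_identity a b cx cy dx dy K k D s :
  D = a * a + b * b -> D <> 0 -> K <> 0 -> (K * K + k * k) * D = 1 ->
  - (- (1 * (s * dx) * a + a * (1 * (s * dx)) + (1 * (s * dy) * b + b * (1 * (s * dy))))
      * / (D * D) * / (2 * K) * (cx * a + cy * b)
     + K * (cx * (1 * (s * dx)) + cy * (1 * (s * dy)))
     + k * (cx * (1 * (s * dy)) + - (cy * (1 * (s * dx))))) =
  s * ((K * (dy * a - dx * b) - (dx * a + dy * b) * k) *
       (K * (cx * b - cy * a) - (cx * a + cy * b) * k)) / (D * K).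
Proof.
  intros ED D0 K0 H.
  set (P1 := cx * a + cy * b). set (Q1 := cx * b - cy * a).
  set (P2 := dx * a + dy * b). set (Q2 := dy * a - dx * b).
  assert (E1 : D * (cx * dx + cy * dy) = P1 * P2 - Q1 * Q2)
    by (rewrite ED; unfold P1, P2, Q1, Q2; ring).
  assert (E2 : D * (cx * dy - cy * dx) = P1 * Q2 + Q1 * P2)
    by (rewrite ED; unfold P1, P2, Q1, Q2; ring).
  apply Rmult_eq_reg_r with (D * D * K);
    [|apply Rmult_integral_contrapositive; split; [now apply Rmult_integral_contrapositive|exact K0]].
  transitivity (s * P2 * P1 * 1 - K * K * D * s * (D * (cx * dx + cy * dy))
    - k * K * D * s * (D * (cx * dy - cy * dx))).
  - unfold P2. field. auto.
  - rewrite E1, E2, <- H. field. auto.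
Qed.

Section Twist.

Context {r : R} {u v tx ty sp ka : R -> R} (F : frenet r u v tx ty sp ka).

(** A point strictly inside the circle tangent at [x] is at distance less than the diameter from the
    point of tangency. *)
Lemma sqdist_bounds x w : x < w < x + 1 -> 0 < sqdist u v x w < 4 * r * r.
Proof.
  intros H. pose proof (frenet_disc F x w H) as P. fold (sqdist u v x w) in P.
  pose proof (fr_unit _ _ _ _ _ _ _ F x) as N. pose proof (fr_r _ _ _ _ _ _ _ F) as Hr.
  set (Q := tx x * (v w - v x) - ty x * (u w - u x)) in *.
  assert (E : (tx x * (u w - u x) + ty x * (v w - v x)) * (tx x * (u w - u x) + ty x * (v w - v x))
    + Q * Q = sqdist u v x w).
  { transitivity ((tx x * tx x + ty x * ty x) * sqdist u v x w);
    [unfold Q, sqdist; ring|rewrite N; ring]. }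
  set (D := sqdist u v x w) in *. set (p := tx x * (u w - u x) + ty x * (v w - v x)) in *.
  assert (0 <= D) by nra. assert (0 < Q) by nra.
  assert (0 < D) by nra. split; [lra|]. nra.
Qed.

Lemma sqdist_lt x w : sqdist u v x w < 4 * r * r.
Proof.
  pose proof (fr_r _ _ _ _ _ _ _ F) as Hr.
  destruct (translate_into_period x w) as [z [h1 h2]].
  assert (E : sqdist u v x w = sqdist u v x (w + IZR z)).
  { unfold sqdist. rewrite !(periodic_Z u), !(periodic_Z v);
    [reflexivity|apply (fr_v1 _ _ _ _ _ _ _ F)|apply (fr_u1 _ _ _ _ _ _ _ F)]. }
  rewrite E. destruct (Req_dec x (w + IZR z)) as [<-|N].
  - unfold sqdist. rewrite !Rminus_diag. nra.
  - apply sqdist_bounds. lra.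
Qed.

(** By [departure_cos_identity] the derivative of the negated cosine is a positive multiple of a
    product of two sines. These are positive because the curve lies inside its tangent circles at
    both ends of the chord. *)
Lemma departure_cos_decr x w w' : x < w -> w < w' -> w' < x + 1 ->
  departure_cos r u v tx ty x w' < departure_cos r u v tx ty x w.
Proof.
  intros h1 h2 h3. apply Ropp_lt_cancel.
  set (K := fun w => chord_slope r (sqdist u v x w)).
  set (P1 := fun w => tx x * (u w - u x) + ty x * (v w - v x)).
  set (Q1 := fun w => tx x * (v w - v x) - ty x * (u w - u x)).
  set (P2 := fun w => tx w * (u w - u x) + ty w * (v w - v x)).
  set (Q2 := fun w => ty w * (u w - u x) - tx w * (v w - v x)).
  set (d := fun w => sp w * ((K w * Q2 w - P2 w / (2 * r)) * (K w * Q1 w - P1 w / (2 * r)))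
     / (sqdist u v x w * K w)).
  pose proof (fr_r _ _ _ _ _ _ _ F) as Hr.
  assert (B : forall c, x < c < x + 1 -> is_derive (fun w => - departure_cos r u v tx ty x w) c (d c) /\ 0 < d c).
  { intros c Hc.
    pose proof (sqdist_bounds x c Hc) as [D0 D4].
    assert (HK : / sqdist u v x c - / (4 * r * r) =
      (4 * r * r - sqdist u v x c) / (4 * r * r * sqdist u v x c)) by (field; lra).
    assert (K0 : 0 < / sqdist u v x c - / (4 * r * r)).
    { rewrite HK. apply Rdiv_lt_0_compat; [lra|]. repeat apply Rmult_lt_0_compat; lra. }
    assert (Kp : 0 < K c) by now apply sqrt_lt_R0.
    assert (K2 : K c * K c = / sqdist u v x c - / (4 * r * r)) by (apply sqrt_sqrt; lra).
    pose proof (fr_u _ _ _ _ _ _ _ F c) as Fu. pose proof (fr_v _ _ _ _ _ _ _ F c) as Fv.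
    split.
    - unfold departure_cos, chord_slope, sqdist. auto_derive.
      + fold (sqdist u v x c). unfold Rminus in K0. unfold sqdist, Rminus in *.
        repeat split; try (now eexists; eauto); lra.
      + derive_value Fu. derive_value Fv.
        change ((u c + - u x) * (u c + - u x) + (v c + - v x) * (v c + - v x)) with (sqdist u v x c).
        change (sqrt (/ sqdist u v x c + - / (4 * r * r))) with (K c).
        apply departure_cos_identity; [reflexivity|lra|lra|].
        rewrite K2. field. lra.
    - unfold d. apply Rdiv_lt_0_compat; [|now apply Rmult_lt_0_compat].
      apply Rmult_lt_0_compat; [apply (fr_sp _ _ _ _ _ _ _ F)|].
      apply Rmult_lt_0_compat.
      (* Reflecting the second coordinate turns the angle at the end point into one of the form
         treated by [chord_angle_pos]. *)
      + pose proof (chord_angle_pos r (tx c) (- ty c) (u c - u x) (- (v c - v x)) Hr) as A.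
        unfold K, sqdist, Q2, P2.
        replace (ty c * (u c - u x) - tx c * (v c - v x)) with
          (tx c * - (v c - v x) - - ty c * (u c - u x)) by ring.
        replace (tx c * (u c - u x) + ty c * (v c - v x)) with
          (tx c * (u c - u x) + - ty c * - (v c - v x)) by ring.
        replace ((u c - u x) * (u c - u x) + (v c - v x) * (v c - v x)) with
          ((u c - u x) * (u c - u x) + - (v c - v x) * - (v c - v x)) by ring.
        apply A.
        * rewrite <- (fr_unit _ _ _ _ _ _ _ F c). ring.
        * pose proof (frenet_disc_end F x c Hc). lra.
      + apply (chord_angle_pos r (tx x) (ty x) (u c - u x) (v c - v x) Hr).
        * apply (fr_unit _ _ _ _ _ _ _ F).
        * apply (frenet_disc F x c Hc). }
  apply (is_derive_lt (fun w => - departure_cos r u v tx ty x w) d w w' h2).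
  - intros c Hc. apply B. lra.
  - intros c Hc. eapply is_derive_continuity_pt, B. lra.
  - intros c Hc. apply B. lra.
Qed.

(** First variation in the starting point. The last term is independent of [w] and cancels whenever
    two end points are compared. *)
Lemma arc_value_derive x w : x < w < x + 1 ->
  is_derive (fun x => arc_value r u v x w) x
    (- sp x * departure_cos r u v tx ty x w
     - / (2 * r) * sp x * (tx x * v x - ty x * u x)).
Proof.
  intros H. pose proof (fr_r _ _ _ _ _ _ _ F) as Hr.
  pose proof (chord_value_derive r _ Hr (sqdist_bounds x w H)) as Hc.
  pose proof (fr_u _ _ _ _ _ _ _ F x) as Fu. pose proof (fr_v _ _ _ _ _ _ _ F x) as Fv.
  unfold arc_value, sqdist in *. auto_derive.
  - repeat split; eexists; eauto.
  - unfold Rminus in Hc. derive_value Fu. derive_value Fv. derive_value Hc.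
    unfold departure_cos, sqdist, Rminus. field. lra.
Qed.

Lemma arc_value_ex_derive_r x w : x < w < x + 1 -> ex_derive (arc_value r u v x) w.
Proof.
  intros H. pose proof (fr_r _ _ _ _ _ _ _ F) as Hr.
  pose proof (chord_value_derive r _ Hr (sqdist_bounds x w H)) as Hc.
  pose proof (fr_u _ _ _ _ _ _ _ F w) as Fu. pose proof (fr_v _ _ _ _ _ _ _ F w) as Fv.
  unfold arc_value, sqdist in *. auto_derive.
  repeat split; eexists; eauto.
Qed.

Lemma frenet_continuity t : continuity_pt u t /\ continuity_pt v t.
Proof.
  split; eapply is_derive_continuity_pt; [apply (fr_u _ _ _ _ _ _ _ F)|apply (fr_v _ _ _ _ _ _ _ F)].
Qed.

Lemma arc_value_lim (x y : nat -> R) (a b : R) : is_lim_seq x a -> is_lim_seq y b ->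
  is_lim_seq (fun m => arc_value r u v (x m) (y m)) (arc_value r u v a b).
Proof.
  intros Hx Hy. pose proof (fr_r _ _ _ _ _ _ _ F) as Hr.
  pose proof (is_lim_seq_continuous u x a (proj1 (frenet_continuity a)) Hx) as ux.
  pose proof (is_lim_seq_continuous v x a (proj2 (frenet_continuity a)) Hx) as vx.
  pose proof (is_lim_seq_continuous u y b (proj1 (frenet_continuity b)) Hy) as uy.
  pose proof (is_lim_seq_continuous v y b (proj2 (frenet_continuity b)) Hy) as vy.
  unfold arc_value. apply is_lim_seq_minus'.
  - apply (is_lim_seq_continuous (chord_value r) (fun m => sqdist u v (x m) (y m)) (sqdist u v a b)).
    + apply chord_value_continuous; [exact Hr|apply sqdist_lt].
    + unfold sqdist. apply is_lim_seq_plus'; apply is_lim_seq_mult'; now apply is_lim_seq_minus'.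
  - apply is_lim_seq_mult'; [apply is_lim_seq_const|].
    apply is_lim_seq_minus'; now apply is_lim_seq_mult'.
Qed.

Lemma arc_value_continuity w x : continuity_pt (fun x => arc_value r u v x w) x.
Proof.
  pose proof (fr_r _ _ _ _ _ _ _ F) as Hr.
  destruct (frenet_continuity x) as [Cu Cv].
  assert (C : forall c : R, continuity_pt (fun _ => c) x)
    by (intros c; apply continuity_pt_const; intros ? ?; reflexivity).
  unfold arc_value. apply continuity_pt_minus.
  - apply (continuity_pt_comp (fun x => sqdist u v x w) (chord_value r)).
    + unfold sqdist. apply continuity_pt_plus; apply continuity_pt_mult; apply continuity_pt_minus; auto.
    + apply chord_value_continuous; [exact Hr|apply sqdist_lt].
  - apply continuity_pt_mult; [apply C|].
    apply continuity_pt_minus; apply continuity_pt_mult; auto.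
Qed.

(** As a function of the starting point, the difference of the values towards [x'] and [y']
    increases, since the departure cosine decreases with the end point. *)
Lemma arc_value_cross x y y' x' : x < y -> y <= y' -> y' < x' -> x' <= x + 1 ->
  arc_value r u v x x' + arc_value r u v y y' <
  arc_value r u v x y' + arc_value r u v y x'.
Proof.
  intros h1 h2 h3 h4. pose proof (fr_r _ _ _ _ _ _ _ F) as Hr.
  assert (H : arc_value r u v x x' - arc_value r u v x y' <
              arc_value r u v y x' - arc_value r u v y y'); [|lra].
  apply (is_derive_lt (fun t => arc_value r u v t x' - arc_value r u v t y')
    (fun t => sp t * (departure_cos r u v tx ty t y' - departure_cos r u v tx ty t x')) x y h1).
  - intros c Hc.
    replace (sp c * _) with
      ((- sp c * departure_cos r u v tx ty c x' - / (2 * r) * sp c * (tx c * v c - ty c * u c)) -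
       (- sp c * departure_cos r u v tx ty c y' - / (2 * r) * sp c * (tx c * v c - ty c * u c))) by ring.
    apply (is_derive_minus (fun t => arc_value r u v t x') (fun t => arc_value r u v t y'));
      apply arc_value_derive; lra.
  - intros c _. apply continuity_pt_minus; apply arc_value_continuity.
  - intros c Hc. apply Rmult_lt_0_compat; [apply (fr_sp _ _ _ _ _ _ _ F)|].
    pose proof (departure_cos_decr c y' x' ltac:(lra) h3 ltac:(lra)). lra.
Qed.

(** Both maxima are critical at [c] with the same incoming derivative [l], so the departure cosines
    towards [w] and [w'] would agree. *)
Lemma arc_value_next p c w w' : p < c < p + 1 -> c < w -> w < w' -> w' < c + 1 ->
  (forall t, p <= t <= p + 1 -> w - 1 <= t <= w ->
    arc_value r u v p t + arc_value r u v t w <= arc_value r u v p c + arc_value r u v c w) ->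
  (forall t, p <= t <= p + 1 -> w' - 1 <= t <= w' ->
    arc_value r u v p t + arc_value r u v t w' <= arc_value r u v p c + arc_value r u v c w') ->
  False.
Proof.
  intros h1 h2 h3 h4 M M'.
  destruct (arc_value_ex_derive_r p c h1) as [l Hl].
  assert (Q : forall z, c < z < c + 1 ->
    (forall t, p <= t <= p + 1 -> z - 1 <= t <= z ->
    arc_value r u v p t + arc_value r u v t z <= arc_value r u v p c + arc_value r u v c z) ->
    l + (- sp c * departure_cos r u v tx ty c z - / (2 * r) * sp c * (tx c * v c - ty c * u c)) = 0).
  { intros z Hz Mz.
    apply (critical_of_max (fun t => arc_value r u v p t + arc_value r u v t z) _
      (Rmax p (z - 1)) (Rmin (p + 1) z) c).
    - split; [apply Rmax_lub_lt|apply Rmin_glb_lt]; lra.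
    - apply (is_derive_plus (arc_value r u v p) (fun t => arc_value r u v t z)); [exact Hl|].
      now apply arc_value_derive.
    - intros t [t1 t2]. pose proof (Rmax_l p (z - 1)). pose proof (Rmax_r p (z - 1)).
      pose proof (Rmin_l (p + 1) z). pose proof (Rmin_r (p + 1) z).
      apply Mz; lra. }
  pose proof (Q w ltac:(lra) M) as E. pose proof (Q w' ltac:(lra) M') as E'.
  pose proof (departure_cos_decr c w w' h2 h3 h4). pose proof (fr_sp _ _ _ _ _ _ _ F c). nra.
Qed.

Lemma arc_value_bounded : exists B, forall x y, arc_value r u v x y <= B.
Proof.
  pose proof (fr_r _ _ _ _ _ _ _ F) as Hr.
  set (C := Rabs (u 0) + Rabs (v 0) + 2 * r).
  exists (r * (PI / 2 + 1) + / (2 * r) * (2 * C * C)).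
  assert (K : forall f : R -> R, forall x, (f x - f 0) * (f x - f 0) <= 2 * r * (2 * r) ->
    Rabs (f x) <= Rabs (f 0) + 2 * r).
  { intros f x H. assert (Rabs (f x - f 0) <= 2 * r).
    { apply Rsqr_le_abs_0 in H. rewrite (Rabs_right (2 * r)) in H; lra. }
    replace (f x) with ((f x - f 0) + f 0) by ring.
    pose proof (Rabs_triang (f x - f 0) (f 0)). lra. }
  assert (B : forall x, Rabs (u x) <= C /\ Rabs (v x) <= C).
  { intros x. pose proof (sqdist_lt 0 x) as H. unfold sqdist in H.
    pose proof (Rabs_pos (u 0)). pose proof (Rabs_pos (v 0)).
    pose proof (Rle_0_sqr (u x - u 0)). pose proof (Rle_0_sqr (v x - v 0)).
    unfold Rsqr in *. unfold C. split.
    - assert (Rabs (u x) <= Rabs (u 0) + 2 * r); [apply K|]; lra.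
    - assert (Rabs (v x) <= Rabs (v 0) + 2 * r); [apply K|]; lra. }
  intros x y. unfold arc_value.
  assert (P1 : chord_value r (sqdist u v x y) <= r * (PI / 2 + 1)).
  { unfold chord_value. apply Rmult_le_compat_l; [lra|].
    pose proof (half_chord_bounds r _ Hr (sqdist_lt x y)).
    apply Rplus_le_compat; [apply asin_bound|apply sqrt_0_1_bound; split; lra]. }
  assert (P2 : - (u x * v y - v x * u y) <= 2 * C * C).
  { destruct (B x) as [ux vx]. destruct (B y) as [uy vy].
    assert (M : forall a b, Rabs a <= C -> Rabs b <= C -> Rabs (a * b) <= C * C).
    { intros a b Ha Hb. rewrite Rabs_mult.
      apply Rmult_le_compat; auto using Rabs_pos. }
    pose proof (M _ _ ux vy) as A. pose proof (M _ _ vx uy) as A'.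
    apply Rabs_le_between in A. apply Rabs_le_between in A'. lra. }
  assert (0 < / (2 * r)) by (apply Rinv_0_lt_compat; lra). nra.
Qed.

Lemma arc_value_twist : twist (arc_value r u v).
Proof.
  split.
  - intros x y. unfold arc_value, sqdist.
    now rewrite (fr_u1 _ _ _ _ _ _ _ F), (fr_v1 _ _ _ _ _ _ _ F).
  - intros x y. unfold arc_value, sqdist.
    now rewrite (fr_u1 _ _ _ _ _ _ _ F), (fr_v1 _ _ _ _ _ _ _ F).
  - intros x. unfold arc_value, sqdist, chord_value.
    rewrite !Rminus_diag, !Rmult_0_l, Rplus_0_l, sqrt_0.
    unfold Rdiv. rewrite Rmult_0_l, asin_0. ring.
  - exact arc_value_cross.
  - exact arc_value_next.
  - exact arc_value_bounded.
  - exact arc_value_lim.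
Qed.

End Twist.

(** * Curves and arcs *)

Definition speed (g : R -> R * R) (t : R) : R :=
  sqrt (Derive (ucoord g) t ^ 2 + Derive (vcoord g) t ^ 2).

Definition utangent (g : R -> R * R) (t : R) : R := Derive (ucoord g) t / speed g t.
Definition vtangent (g : R -> R * R) (t : R) : R := Derive (vcoord g) t / speed g t.

Lemma speed_pos g : regular g -> forall t, 0 < speed g t.
Proof.
  intros H t. apply sqrt_lt_R0. apply Rnot_le_lt. intros N. apply (H t).
  pose proof (pow2_ge_0 (Derive (ucoord g) t)). pose proof (pow2_ge_0 (Derive (vcoord g) t)).
  f_equal; apply Rsqr_0_uniq; unfold Rsqr; lra.
Qed.

Lemma Derive_periodic (f : R -> R) t : ex_derive f (t + 1) ->
  (forall s, f (s + 1) = f s) -> Derive f (t + 1) = Derive f t.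
Proof.
  intros He Hf. rewrite <- (Derive_ext (fun s => f (s + 1)) f t Hf).
  symmetry. apply is_derive_unique. auto_derive; [exact He|].
  change (Derive (fun x : R => f x) (t + 1)) with (Derive f (t + 1)). ring.
Qed.

Lemma tangent_derive g t : smooth g -> regular g ->
  is_derive (utangent g) t (- (curvature g t * speed g t * vtangent g t)) /\
  is_derive (vtangent g) t (curvature g t * speed g t * utangent g t).
Proof.
  intros Hs Hr. pose proof (speed_pos g Hr t) as Sp.
  assert (U2 : is_derive (Derive (ucoord g)) t (Derive_n (ucoord g) 2 t))
    by apply Derive_correct, (proj1 (Hs 2%nat t)).
  assert (V2 : is_derive (Derive (vcoord g)) t (Derive_n (vcoord g) 2 t))
    by apply Derive_correct, (proj2 (Hs 2%nat t)).
  assert (S2 : speed g t * speed g t = Derive (ucoord g) t ^ 2 + Derive (vcoord g) t ^ 2).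
  { apply sqrt_sqrt. pose proof (pow2_ge_0 (Derive (ucoord g) t)).
    pose proof (pow2_ge_0 (Derive (vcoord g) t)). lra. }
  assert (S0 : 0 < Derive (ucoord g) t ^ 2 + Derive (vcoord g) t ^ 2) by nra.
  unfold curvature, utangent, vtangent.
  set (u1 := Derive (ucoord g)) in *. set (v1 := Derive (vcoord g)) in *.
  set (u2 := Derive_n (ucoord g) 2 t) in *. set (v2 := Derive_n (vcoord g) 2 t) in *.
  change (sqrt (u1 t ^ 2 + v1 t ^ 2)) with (speed g t).
  assert (SD : is_derive (speed g) t ((u1 t * u2 + v1 t * v2) / speed g t)).
  { unfold speed at 1. fold u1 v1. auto_derive.
    - repeat split; try (eexists; eauto). simpl in S0. lra.
    - derive_value U2. derive_value V2.
      replace (sqrt _) with (speed g t); [field; lra|].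
      unfold speed. fold u1 v1. f_equal; ring. }
  split; auto_derive; try (repeat split; try (eexists; eauto); lra).
  - derive_value U2. derive_value SD. clearbody u1 v1 u2 v2.
    set (s := speed g t) in *. clearbody s.
    field_simplify_eq; [|lra].
    replace (s ^ 2) with (u1 t ^ 2 + v1 t ^ 2) by lra. ring.
  - derive_value V2. derive_value SD. clearbody u1 v1 u2 v2.
    set (s := speed g t) in *. clearbody s.
    field_simplify_eq; [|lra].
    replace (s ^ 2) with (u1 t ^ 2 + v1 t ^ 2) by lra. ring.
Qed.

Lemma curve_simple g : convex_curve g -> forall s t, s < t < s + 1 -> g t <> g s.
Proof.
  intros H s t Hst E.
  destruct (translate_into_period 0 s) as [z Hz].
  destruct (translate_into_period 0 t) as [z' Hz'].
  pose proof (cc_injective _ H (s + IZR z) (t + IZR z') ltac:(lra) ltac:(lra)) as Hi.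
  rewrite !(periodic_Z g (cc_periodic _ H)) in Hi. specialize (Hi (eq_sym E)).
  assert (0 < z - z' < 1)%Z; [|lia].
  split; apply lt_IZR; rewrite minus_IZR; lra.
Qed.

Lemma convex_curve_frenet g r : convex_curve g -> 0 < r ->
  (forall t, 1 / r < curvature g t) ->
  frenet r (ucoord g) (vcoord g) (utangent g) (vtangent g) (speed g)
    (fun t => curvature g t * speed g t).
Proof.
  intros H Hr Hk.
  pose proof (speed_pos g (cc_regular _ H)) as Sp.
  assert (Du : forall t, is_derive (ucoord g) t (Derive (ucoord g) t)).
  { intros t. apply Derive_correct, (proj1 (cc_smooth _ H 1%nat t)). }
  assert (Dv : forall t, is_derive (vcoord g) t (Derive (vcoord g) t)).
  { intros t. apply Derive_correct, (proj2 (cc_smooth _ H 1%nat t)). }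
  assert (u1 : forall t, ucoord g (t + 1) = ucoord g t).
  { intros t. unfold ucoord. now rewrite (cc_periodic _ H). }
  assert (v1 : forall t, vcoord g (t + 1) = vcoord g t).
  { intros t. unfold vcoord. now rewrite (cc_periodic _ H). }
  assert (Du1 : forall t, Derive (ucoord g) (t + 1) = Derive (ucoord g) t).
  { intros t. apply Derive_periodic; [eexists; apply Du|exact u1]. }
  assert (Dv1 : forall t, Derive (vcoord g) (t + 1) = Derive (vcoord g) t).
  { intros t. apply Derive_periodic; [eexists; apply Dv|exact v1]. }
  assert (Fu : forall t, is_derive (ucoord g) t (speed g t * utangent g t)).
  { intros t. replace (speed g t * utangent g t) with (Derive (ucoord g) t); [apply Du|].
    unfold utangent. field. specialize (Sp t). lra. }
  assert (Fv : forall t, is_derive (vcoord g) t (speed g t * vtangent g t)).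
  { intros t. replace (speed g t * vtangent g t) with (Derive (vcoord g) t); [apply Dv|].
    unfold vtangent. field. specialize (Sp t). lra. }
  assert (Fn : forall t, utangent g t * utangent g t + vtangent g t * vtangent g t = 1).
  { intros t. specialize (Sp t).
    assert (S2 : speed g t * speed g t = Derive (ucoord g) t ^ 2 + Derive (vcoord g) t ^ 2).
    { apply sqrt_sqrt. pose proof (pow2_ge_0 (Derive (ucoord g) t)).
      pose proof (pow2_ge_0 (Derive (vcoord g) t)). lra. }
    unfold utangent, vtangent. field_simplify_eq; [|lra]. simpl in *. lra. }
  assert (Kp : forall t, 0 < curvature g t).
  { intros t. apply Rlt_trans with (1 / r); [|apply Hk].
    apply Rdiv_lt_0_compat; lra. }
  assert (Ft := fun t => tangent_derive g t (cc_smooth _ H) (cc_regular _ H)).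
  split; auto.
  - intros t. apply Ft.
  - intros t. apply Ft.
  - intros t. specialize (Hk t). specialize (Sp t).
    apply (Rmult_lt_compat_l r) in Hk; [|exact Hr].
    replace (r * (1 / r)) with 1 in Hk by (field; lra). nra.
  - intros t. unfold utangent, speed. now rewrite Du1, Dv1.
  - intros t. unfold vtangent, speed. now rewrite Du1, Dv1.
  - assert (TS : forall s t, tangent_side g s t = speed g s *
      (utangent g s * (vcoord g t - vcoord g s) - vtangent g s * (ucoord g t - ucoord g s))).
    { intros s t. specialize (Sp s). unfold tangent_side, utangent, vtangent. field. lra. }
    intros s t Hst. destruct (cc_strictly_convex _ H s) as [P|P].
    + specialize (P t (curve_simple g H s t Hst)). rewrite TS in P. specialize (Sp s). nra.
    + (* On the other hand positive curvature bends the curve to the left near [s]. *)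
      exfalso.
      destruct (decrease_after_critical
        (fun t => - (utangent g s * (vcoord g t - vcoord g s) - vtangent g s * (ucoord g t - ucoord g s)))
        (speed g) (fun t => - (utangent g s * vtangent g t - vtangent g s * utangent g t))
        s (- (curvature g s * speed g s)) (s + 1)) as (t' & Ht' & Hlt).
      * lra.
      * intros t'. specialize (Fu t'). specialize (Fv t'). auto_derive.
        -- repeat split; eexists; eauto.
        -- derive_value Fu. derive_value Fv. ring.
      * exact Sp.
      * destruct (Ft s) as [Fx Fy]. auto_derive.
        -- repeat split; eexists; eauto.
        -- derive_value Fx. derive_value Fy.
           transitivity (- (curvature g s * speed g s) *
             (utangent g s * utangent g s + vtangent g s * vtangent g s)); [ring|].
           rewrite Fn. ring.
      * pose proof (Rmult_lt_0_compat _ _ (Kp s) (Sp s)). lra.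
      * ring.
      * rewrite !Rminus_diag in Hlt.
        specialize (P t' (curve_simple g H s t' Ht')). rewrite TS in P. specialize (Sp s). nra.
Qed.

(** * Length, area and existence of arcs *)

Lemma arc_point_derive r a t :
  Derive (ucoord (arc_point r a)) t = - (r * sin t) /\
  Derive (vcoord (arc_point r a)) t = r * cos t.
Proof.
  split; apply is_derive_unique; unfold ucoord, vcoord, arc_point; simpl; auto_derive; auto; ring.
Qed.

Lemma arc_length r a : 0 < r ->
  curve_length (arc_point r a) (angle_from a) (angle_to a) = r * (angle_to a - angle_from a).
Proof.
  intros Hr. unfold curve_length.
  rewrite (RInt_ext _ (fun _ => r)).
  - rewrite RInt_const. unfold scal; simpl; unfold mult; simpl. ring.
  - intros t _. destruct (arc_point_derive r a t) as [-> ->].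
    replace ((- (r * sin t)) ^ 2 + (r * cos t) ^ 2) with (r * r).
    + apply sqrt_square. lra.
    + pose proof (sin2_cos2 t) as E. unfold Rsqr in E.
      transitivity (r * r * (sin t * sin t + cos t * cos t)); [rewrite E|]; ring.
Qed.

Lemma arc_area r a : area_integral (arc_point r a) (angle_from a) (angle_to a) =
  / 2 * (r * r * (angle_to a - angle_from a)
    + fst (center a) * r * (sin (angle_to a) - sin (angle_from a))
    - snd (center a) * r * (cos (angle_to a) - cos (angle_from a))).
Proof.
  unfold area_integral. f_equal.
  set (cx := fst (center a)). set (cy := snd (center a)).
  rewrite (RInt_ext _ (fun t => (cx + r * cos t) * (r * cos t) - (cy + r * sin t) * - (r * sin t))).
  2: { intros t _. destruct (arc_point_derive r a t) as [-> ->]. reflexivity. }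
  apply is_RInt_unique.
  set (f := fun t => r * r * t + cx * r * sin t - cy * r * cos t).
  replace (r * r * _ + _ - _) with (f (angle_to a) - f (angle_from a)) by (unfold f; ring).
  apply (is_RInt_derive f).
  - intros t _. unfold f. auto_derive; [auto|].
    pose proof (sin2_cos2 t) as E. unfold Rsqr in E.
    transitivity (r * r * (sin t * sin t + cos t * cos t) + cx * r * cos t + cy * r * sin t);
      [rewrite E|]; ring.
  - intros t _. apply (ex_derive_continuous (fun t => (cx + r * cos t) * (r * cos t) - (cy + r * sin t) * - (r * sin t))).
    auto_derive. auto.
Qed.

Lemma arc_joins_value r a A B : 0 < r -> arc_joins r a A B ->
  curve_length (arc_point r a) (angle_from a) (angle_to a)
  - / r * area_integral (arc_point r a) (angle_from a) (angle_to a) =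
  chord_value r ((fst B - fst A) * (fst B - fst A) + (snd B - snd A) * (snd B - snd A))
  - / (2 * r) * (fst A * snd B - snd A * fst B).
Proof.
  intros Hr (Hab & EA & EB). rewrite arc_length, arc_area by exact Hr.
  subst A B. unfold arc_point. simpl.
  set (al := angle_from a) in *. set (be := angle_to a) in *.
  set (cx := fst (center a)). set (cy := snd (center a)).
  (* In terms of the half-angle [h] the chord is [2 * r * sin h]; as [h < PI / 2], [asin] recovers
     [h], and [cos h] is the positive root. *)
  set (h := (be - al) / 2).
  assert (Hh : 0 <= h < PI / 2) by (unfold h; lra).
  pose proof (sin2_cos2 h) as Eh. unfold Rsqr in Eh.
  assert (Sh : 0 <= sin h) by (apply sin_ge_0; lra).
  assert (Ch : 0 < cos h) by (apply cos_gt_0; lra).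
  set (m := (be + al) / 2).
  pose proof (sin2_cos2 m) as Em. unfold Rsqr in Em.
  assert (Hal : al = m - h) by (unfold m, h; field).
  assert (Hbe : be = m + h) by (unfold m, h; field).
  rewrite Hal, Hbe, sin_plus, sin_minus, cos_plus, cos_minus.
  set (sm := sin m) in *. set (cm := cos m) in *. set (sh := sin h) in *. set (ch := cos h) in *.
  match goal with |- _ = chord_value r ?D - _ =>
    replace D with ((2 * r * sh) * (2 * r * sh)) end.
  2: { transitivity ((2 * r * sh) * (2 * r * sh) * (sm * sm + cm * cm)); [rewrite Em|]; ring. }
  unfold chord_value. rewrite sqrt_square by nra.
  replace (2 * r * sh / (2 * r)) with sh by (field; lra).
  replace (1 - sh²) with (ch * ch) by (unfold Rsqr; lra). rewrite sqrt_square by lra.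
  replace (asin sh) with h by (symmetry; apply asin_sin; lra).
  clearbody sm cm sh ch h m.
  apply Rminus_diag_uniq.
  match goal with |- ?e = 0 => transitivity (r * ch * sh * (sm * sm + cm * cm - 1)) end.
  - field. lra.
  - rewrite Em. ring.
Qed.

Lemma unit_vector_angle x y : x * x + y * y = 1 -> exists b, cos b = x /\ sin b = y.
Proof.
  intros H. assert (Hx : -1 <= x <= 1) by nra.
  assert (Hs : sqrt (1 - x²) = Rabs y).
  { replace (1 - x²) with (y²) by (unfold Rsqr; lra). apply sqrt_Rsqr_abs. }
  destruct (Rle_lt_dec 0 y) as [h|h].
  - exists (acos x). rewrite cos_acos, sin_acos, Hs, Rabs_right by lra. auto.
  - exists (- acos x). rewrite cos_neg, sin_neg, cos_acos, sin_acos, Hs, Rabs_left by lra.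
    split; [reflexivity|ring].
Qed.

Lemma arc_exists r (A B : R * R) : 0 < r ->
  (fst B - fst A) * (fst B - fst A) + (snd B - snd A) * (snd B - snd A) < 4 * r * r ->
  exists a, arc_joins r a A B.
Proof.
  intros Hr HD. set (D := _ + _) in HD.
  pose proof (half_chord_bounds r D Hr HD) as Hs. set (s := sqrt D / (2 * r)) in *.
  assert (D0 : 0 <= D).
  { unfold D. pose proof (Rle_0_sqr (fst B - fst A)). pose proof (Rle_0_sqr (snd B - snd A)).
    unfold Rsqr in *. lra. }
  assert (Es : 2 * r * s = sqrt D) by (unfold s; field; lra).
  assert (Q : exists b, sqrt D * cos b = fst B - fst A /\ sqrt D * sin b = snd B - snd A).
  { destruct (Req_dec D 0) as [Z|N].
    (* A degenerate chord has no direction, and any angle serves. *)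
    - exists 0. assert (Z' := Z). unfold D in Z'. apply Rplus_sqr_eq_0 in Z'.
      destruct Z' as [-> ->]. rewrite Z, sqrt_0. split; ring.
    - assert (Dp : 0 < sqrt D) by (apply sqrt_lt_R0; lra).
      assert (Sq : sqrt D * sqrt D = D) by (apply sqrt_sqrt; lra).
      destruct (unit_vector_angle ((fst B - fst A) / sqrt D) ((snd B - snd A) / sqrt D)) as (b & Cb & Sb).
      + unfold D at 3 in Sq. apply Rmult_eq_reg_r with (sqrt D * sqrt D); [|nra].
        rewrite Rmult_1_l. rewrite Sq at 2. field. lra.
      + exists b. rewrite Cb, Sb. split; field; lra. }
  destruct Q as (b & Ex & Ey).
  assert (Ha : 0 <= asin s < PI / 2).
  { split; [|apply asin_bound_lt; lra].
    apply Rnot_lt_le. intros N. pose proof (asin_bound s). pose proof PI_RGT_0.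
    pose proof (sin_lt_0_var (asin s) ltac:(lra) N) as P. rewrite sin_asin in P; lra. }
  (* [b] is the direction of the chord. The direction of travel turns from [b - asin s] to
     [b + asin s], and the angle of position lags behind it by [PI / 2]. *)
  set (al := b - PI / 2 - asin s). set (be := b - PI / 2 + asin s).
  exists (Arc (fst A - r * cos al, snd A - r * sin al) al be).
  assert (Ss : sin (asin s) = s) by (apply sin_asin; lra).
  repeat split; simpl.
  - unfold al, be. lra.
  - unfold al, be. lra.
  - rewrite (surjective_pairing A) at 3. unfold arc_point; simpl. f_equal; ring.
  - rewrite (surjective_pairing B). unfold arc_point; simpl.
    unfold al, be. rewrite !(cos_plus (b - PI / 2)), !(sin_plus (b - PI / 2)),
      !(cos_minus (b - PI / 2)), !(sin_minus (b - PI / 2)), Ss.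
    rewrite cos_minus, sin_minus, cos_PI2, sin_PI2.
    f_equal.
    + transitivity (fst A + 2 * r * s * cos b); [ring|]. rewrite Es, Ex. ring.
    + transitivity (snd A + 2 * r * s * sin b); [ring|]. rewrite Es, Ey. ring.
Qed.

(** * From polygons to chains, and the inequality *)

Lemma sum_sub_action L c f h x n :
  (forall i, (i <= n)%nat -> f i - c * h i = L (x i) (x (S i))) ->
  sum_f_R0 f n - c * sum_f_R0 h n = action L (S n) x.
Proof.
  induction n as [|n IH]; intros H.
  - simpl. rewrite <- H by lia. ring.
  - change (action L (S (S n)) x) with (action L (S n) x + L (x (S n)) (x (S (S n)))).
    rewrite <- IH by (intros; apply H; lia). rewrite <- H by lia. simpl. ring.
Qed.

Lemma polygon_value_action g r p q y : 0 < r -> (1 <= q)%nat ->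
  (forall x w, sqdist (ucoord g) (vcoord g) x w < 4 * r * r) ->
  polygon_value g r p q y <->
  exists x, chain p q x /\ y = action (arc_value r (ucoord g) (vcoord g)) q x.
Proof.
  intros Hr Hq Hd.
  assert (V : forall x a, inscribed_polygon g r p q x a ->
    perimeter r q a - / r * enclosed_area r q a = action (arc_value r (ucoord g) (vcoord g)) q x).
  { intros x a (_ & _ & Ha). replace q with (S (q - 1)) at 3 by lia.
    apply sum_sub_action. intros i Hi.
    exact (arc_joins_value r (a i) _ _ Hr (Ha i ltac:(lia))). }
  split.
  - intros (x & a & Hp & ->). exists x. split; [|now apply V].
    destruct Hp as (H1 & H2 & _). now split.
  - intros (x & [H1 H2] & ->).
    destruct (functional_choice (fun i a => arc_joins r a (g (x i)) (g (x (S i))))) as [a Ha].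
    { intros i. apply arc_exists; [exact Hr|apply Hd]. }
    assert (Hp : inscribed_polygon g r p q x a)
      by (split; [exact H1|split; [exact H2|intros i _; apply Ha]]).
    exists x, a. split; [exact Hp|symmetry; now apply V].
Qed.

Lemma is_greatest_Lub_Rbar E m : is_greatest E m -> real (Lub_Rbar E) = m.
Proof.
  intros [H1 H2]. rewrite (is_lub_Rbar_unique E (Finite m)); [reflexivity|].
  split; [intros y Hy; now apply H2|]. intros b Hb. now apply Hb.
Qed.

Theorem mainTheorem8 (g : R -> R * R) (r kmin : R)
  (hg : convex_curve g)
  (hk : forall t, 0 < curvature g t)
  (hkmin : is_least (fun y => exists t, y = curvature g t) kmin)
  (hr : 0 < r)
  (hrk : 1 / r < kmin) :
  exists M : nat -> nat -> R,
    (forall p q : nat, (1 <= p)%nat -> (p < q)%nat ->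
       is_greatest (polygon_value g r p q) (M p q)) /\
    (forall p q : nat, (1 <= p)%nat -> (1 <= q)%nat -> Nat.gcd p q = 1%nat ->
       (p < q - 1)%nat ->
       M p (q - 1)%nat + M p (q + 1)%nat < 2 * M p q).
Proof.
  assert (F := convex_curve_frenet g r hg hr
    (fun t => Rlt_le_trans _ _ _ hrk (proj2 hkmin _ (ex_intro _ t eq_refl)))).
  pose proof (arc_value_twist F) as T.
  set (L := arc_value r (ucoord g) (vcoord g)) in T.
  assert (G : forall p q x, (1 <= q)%nat -> chain p q x ->
    (forall y, chain p q y -> action L q y <= action L q x) ->
    is_greatest (polygon_value g r p q) (action L q x)).
  { intros p q x Hq Cx Mx. split.
    - apply polygon_value_action; auto; [apply (sqdist_lt F)|]. now exists x.
    - intros y Hy. apply polygon_value_action in Hy; auto; [|apply (sqdist_lt F)].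
      destruct Hy as (z & Cz & ->). now apply Mx. }
  (* The least upper bound is a total function of [p] and [q]; it is the greatest value wherever one
     is attained. *)
  exists (fun p q => real (Lub_Rbar (polygon_value g r p q))). split.
  - intros p q Hp Hpq. destruct (maximal_chain L p q T Hp Hpq) as (x & Cx & Mx).
    pose proof (G p q x ltac:(lia) Cx Mx) as Gx. now rewrite (is_greatest_Lub_Rbar _ _ Gx).
  - intros p q Hp _ _ Hpq.
    destruct (maximal_chain L p (q - 1) T Hp ltac:(lia)) as (x & Cx & Mx).
    destruct (maximal_chain L p (q + 1) T Hp ltac:(lia)) as (y & Cy & My).
    destruct (maximal_chain L p q T Hp ltac:(lia)) as (z & Cz & Mz).
    rewrite (is_greatest_Lub_Rbar _ _ (G p (q - 1)%nat x ltac:(lia) Cx Mx)),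
      (is_greatest_Lub_Rbar _ _ (G p (q + 1)%nat y ltac:(lia) Cy My)),
      (is_greatest_Lub_Rbar _ _ (G p q z ltac:(lia) Cz Mz)).
    now apply (action_max_concave L p q).
Qed.
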